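(* Let $d\ge1$ and $0<\alpha<d+1$. Then the following hold. (1) For $q\in[1,\infty]$, there exists a constant $C>0$ such that $\|H_{\mathrm{par}}^{-\alpha/2}f\|_{L^q(\mathbb R^{d+1})}\le C\|f\|_{L^1(\mathbb R^{d+1})}$ for all $f\in L^1(\mathbb R^{d+1})$ if and only if $1\le q<\frac{d+1}{d+1-\alpha}$. (2) For $p\in[1,\infty]$, there exists a constant $C>0$ such that $\|H_{\mathrm{par}}^{-\alpha/2}f\|_{L^\infty(\mathbb R^{d+1})}\le C\|f\|_{L^p(\mathbb R^{d+1})}$ for all $f\in L^p(\mathbb R^{d+1})$ if and only if $p>\frac{d+1}{\alpha}$. (3) If $1<p<\infty$, $1<q<\infty$ and $\frac1p-\frac{\alpha}{d+1}\le\frac1q<\frac1p$, then there exists a constant $C>0$ such that $\|H_{\mathrm{par}}^{-\alpha/2}f\|_{L^q(\mathbb R^{d+1})}\le C\|f\|_{L^p(\mathbb R^{d+1})}$ for all $f\in L^p(\mathbb R^{d+1})$.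
   Context: Write $z=(\rho,x)\in\mathbb R\times\mathbb R^d$. The partial harmonic oscillator is $H_{\mathrm{par}}=-\partial_\rho^2-\Delta_x+|x|^2$ on $\mathbb R^{d+1}$. For $s>0$, $H_{\mathrm{par}}^{-s}=\frac1{\Gamma(s)}\int_0^\infty t^{s-1}e^{-tH_{\mathrm{par}}}\,dt$ is, on every $L^p(\mathbb R^{d+1})$ with $1\le p\le\infty$, the bounded integral operator with positive kernel $K_s(z,z')=\frac1{\Gamma(s)}\int_0^\infty t^{s-1}E(t,z,z')\,dt$, where $$E(t,z,z')=2^{-\frac{d+2}2}\pi^{-\frac{d+1}2}t^{-1/2}(\sinh 2t)^{-d/2}\exp\Big(-\tfrac14(2\coth 2t-\tanh t)|x-x'|^2-\tfrac{\tanh t}4|x+x'|^2-\tfrac{(\rho-\rho')^2}{4t}\Big)$$ is the integral kernel of $e^{-tH_{\mathrm{par}}}$. *)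

(* Defs.v *)
From HB Require Import structures.
From mathcomp Require Import all_boot all_order all_algebra.
From mathcomp Require Import complex.
From mathcomp Require Import all_classical all_reals all_analysis.

Set Implicit Arguments.
Unset Strict Implicit.
Unset Printing Implicit Defensive.

Import Order.TTheory GRing.Theory Num.Theory.
Import numFieldNormedType.Exports.

Local Open Scope classical_set_scope.
Local Open Scope ring_scope.

(* The sigma-finite instance that the library declares for [m1 \x m2] is only
   found when m1 and m2 are subprobabilities, hence this lemma. *)
Lemma sigma_finite_prod d1 d2 (T1 : measurableType d1) (T2 : measurableType d2)
    (R : realType) (m1 : {sigma_finite_measure set T1 -> \bar R})
    (m2 : {sigma_finite_measure set T2 -> \bar R}) :
  sigma_finite setT (m1 \x m2)%E.
Proof.
have /sigma_finiteP[F [TF ndF Foo]] := sigma_finiteT m1.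
have /sigma_finiteP[G [TG ndG Goo]] := sigma_finiteT m2.
exists (fun n => F n `*` G n).
  rewrite -setXTT TF TG predeqE => -[x y]; split.
    move=> [/= [n _ Fnx] [k _ Gky]]; exists (maxn n k) => //; split.
    - by move: x Fnx; exact/subsetPset/ndF/leq_maxl.
    - by move: y Gky; exact/subsetPset/ndG/leq_maxr.
  by move=> [n _ []/= ? ?]; split; exists n.
move=> k; have [? ?] := Foo k; have [? ?] := Goo k.
split; first exact: measurableX.
by rewrite product_measure1E// lte_mul_pinfty// ge0_fin_numE.
Qed.

(* d-dimensional Lebesgue measure on the product sigma-algebra of
   [d.-tuple (measurableTypeR R)], by recursion on d: for d = 0 it is the unit
   mass at the empty tuple, and for d.+1 it is the image of the product of the
   one- and d-dimensional measures under (a, t) |-> a :: t. *)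
Section lebesgue_tuple.
Context {R : realType}.
Local Notation rT := (measurableTypeR R).

Section step.
Variables (n : nat) (m : {sigma_finite_measure set (n.-tuple rT) -> \bar R}).

Definition consT (p : rT * n.-tuple rT) : n.+1.-tuple rT := [tuple of p.1 :: p.2].

Lemma measurable_consT : measurable_fun [set: rT * n.-tuple rT] consT.
Proof. exact: (measurable_cons measurable_fst measurable_snd). Qed.

Definition lebesgue_cons : set (n.+1.-tuple rT) -> \bar R :=
  pushforward (lebesgue_measure \x m)%E consT.

Let lebesgue_cons0 : lebesgue_cons set0 = 0%E.
Proof. by rewrite /lebesgue_cons /pushforward preimage_set0 measure0. Qed.

Let lebesgue_cons_ge0 A : (0 <= lebesgue_cons A)%E.
Proof. by rewrite /lebesgue_cons /pushforward measure_ge0. Qed.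

Let lebesgue_cons_sigma_additive : semi_sigma_additive lebesgue_cons.
Proof.
move=> F mF tF mUF; rewrite /lebesgue_cons /pushforward preimage_bigcup.
apply: measure_semi_sigma_additive.
- by move=> i; rewrite -[X in measurable X]setTI; exact: measurable_consT.
- apply/trivIsetP => /= i j _ _ ij; rewrite -preimage_setI.
  by move/trivIsetP : tF => /(_ _ _ _ _ ij) ->//; rewrite preimage_set0.
- by rewrite -preimage_bigcup -[X in measurable X]setTI; exact: measurable_consT.
Qed.

HB.instance Definition _ := isMeasure.Build _ _ _ lebesgue_cons
  lebesgue_cons0 lebesgue_cons_ge0 lebesgue_cons_sigma_additive.

Let lebesgue_cons_sigma_finite : sigma_finite setT lebesgue_cons.
Proof.
have [F FT Foo] := sigma_finite_prod (@lebesgue_measure R) m.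
pose uncons (t : n.+1.-tuple rT) := (thead t, [tuple of behead t]).
have consK : cancel consT uncons.
  by case=> a t; rewrite /uncons theadE; congr (_, _); exact: val_inj.
have muncons : measurable_fun [set: n.+1.-tuple rT] uncons.
  apply: measurable_fun_pair => /=; first exact: measurable_tnth.
  exact: measurable_behead.
exists (fun k => uncons @^-1` F k).
  by rewrite -preimage_bigcup -FT preimage_setT.
move=> k; have [mF Fk] := Foo k; split.
  by rewrite -[X in measurable X]setTI; exact: muncons.
rewrite /lebesgue_cons /pushforward -comp_preimage.
by rewrite (_ : uncons \o consT = id)//; apply/funext => p /=; rewrite consK.
Qed.

HB.instance Definition _ := Measure_isSigmaFinite.Build _ _ _ lebesgue_cons
  lebesgue_cons_sigma_finite.

End step.

Fixpoint lebesgue_tuple (n : nat) :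
    {sigma_finite_measure set (n.-tuple rT) -> \bar R} :=
  match n with
  | 0%N => \d_([tuple] : 0.-tuple rT)
  | n'.+1 => lebesgue_cons (lebesgue_tuple n')
  end.

End lebesgue_tuple.

Section real_functions.
Context {R : realType}.
Implicit Types s t : R.

Definition sinh t : R := (expR t - expR (- t)) / 2.
Definition cosh t : R := (expR t + expR (- t)) / 2.
Definition tanh t : R := sinh t / cosh t.
Definition coth t : R := cosh t / sinh t.

Definition Gamma s : R :=
  Rintegral lebesgue_measure `]0, +oo[ (fun t => t `^ (s - 1) * expR (- t)).

End real_functions.

(* R^(d+1), whose points are written z = (rho, x). *)
Definition space (R : realType) (d : nat) : Type :=
  (measurableTypeR R * d.-tuple (measurableTypeR R))%type.

HB.instance Definition _ (R : realType) (d : nat) :=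
  Measurable.copy (space R d)
    (measurableTypeR R * d.-tuple (measurableTypeR R))%type.

Section partial_harmonic_oscillator.
Context {R : realType} {d : nat}.
Implicit Types (t s : R) (z : space R d) (f : space R d -> R[i]) (p : \bar R).

Definition lebesgue_space : set (space R d) -> \bar R :=
  (lebesgue_measure \x lebesgue_tuple d)%E.

HB.instance Definition _ := Measure.copy lebesgue_space
  (lebesgue_measure \x lebesgue_tuple d)%E.
HB.instance Definition _ := Measure_isSigmaFinite.Build _ _ _ lebesgue_space
  (sigma_finite_prod lebesgue_measure (lebesgue_tuple d)).

Definition sqdist (x x' : d.-tuple R) : R :=
  \sum_(i < d) (tnth x i - tnth x' i) ^+ 2.
Definition sqsum (x x' : d.-tuple R) : R :=
  \sum_(i < d) (tnth x i + tnth x' i) ^+ 2.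

Definition heat_kernel t z z' : R :=
  2 `^ (- (d.+2%:R / 2)) * pi `^ (- (d.+1%:R / 2)) * t `^ (- (1 / 2))
  * sinh (2 * t) `^ (- (d%:R / 2))
  * expR (- (1 / 4) * (2 * coth (2 * t) - tanh t) * sqdist z.2 z'.2
          - tanh t / 4 * sqsum z.2 z'.2
          - ((z.1 : R) - (z'.1 : R)) ^+ 2 / (4 * t)).

(* For d >= 1 and s > 0, this is +oo at most on the diagonal z = z'. *)
Definition Hpar_kernel s z z' : \bar R :=
  ((Gamma s)^-1%:E *
   \int[lebesgue_measure]_(t in `]0%R, +oo[)
     (t `^ (s - 1) * heat_kernel t z z')%:E)%E.

(* [Hpar_pow s] is H_par^(-s), as an integral operator on complex-valued
   functions; the integral is taken on real and imaginary parts. For d >= 1,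
   s > 0 and f in L^p with 1 <= p <= +oo, it converges absolutely for almost
   every z, so the value 0 given by [fine] to divergent integrals only matters
   on a null set. *)
Definition Hpar_pow s f z : R[i] :=
  Complex
    (fine (\int[lebesgue_space]_z' (Hpar_kernel s z z' * (complex.Re (f z'))%:E)))
    (fine (\int[lebesgue_space]_z' (Hpar_kernel s z z' * (complex.Im (f z'))%:E))).

Definition Lp_norm p f : \bar R :=
  Lnorm lebesgue_space p (fun z => (Normc.normc (f z))%:E).

Definition in_Lp p f : Prop :=
  [/\ measurable_fun [set: space R d] (fun z => complex.Re (f z)),
      measurable_fun [set: space R d] (fun z => complex.Im (f z))
    & (Lp_norm p f < +oo)%E].

End partial_harmonic_oscillator.

Definition Hpar_pow_bounded (R : realType) (d : nat) (s : R) (p q : \bar R) :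
    Prop :=
  exists C : R, 0 < C /\
    forall f : space R d -> R[i], in_Lp p f ->
      (Lp_norm q (Hpar_pow s f) <= C%:E * Lp_norm p f)%E.

(* Main.v *)
From HB Require Import structures.
From mathcomp Require Import all_boot all_order all_algebra.
From mathcomp Require Import complex lra ring.
From mathcomp Require Import all_classical all_reals all_analysis.
From mathcomp Require Import measurable_realfun ess_sup_inf.
Require Import Defs.

Set Implicit Arguments.
Unset Strict Implicit.
Unset Printing Implicit Defensive.

Import Order.TTheory GRing.Theory Num.Theory.
Import numFieldNormedType.Exports.

Local Open Scope classical_set_scope.
Local Open Scope ring_scope.

(** Write n = d + 1 and s = alpha / 2. By subordination the kernel K of H^(-s)
    is the integral over t of t^(s-1) times the heat kernel, and everything
    follows from comparing K with Riesz kernels |z - z'|^(b - n).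

    Upper bounds on K. The heat kernel is at most
    C t^(-n/2) e^(-dt/2) e^(-|z-z'|^2/8t). The exponential decay in time allows
    to replace t^(s-1) by t^(b/2-1) for any b <= 2 s, whence
    K <= C_b |z - z'|^(b-n) for all such b (Hpar_kernel_le), b being chosen
    according to the application and possibly differently near the diagonal
    and far from it. Riesz kernels are in turn dominated by sums
    of weighted indicators of dyadic cubes (Hpar_kernel_le_cube_sums), so that
    integrals against K reduce to geometric series (Hpar_int_le).

    Boundedness. If p > n / (2 s), Hoelder's inequality on each cube gives
    L^p -> L^oo. By the symmetry of K and duality (dual_Lq_bound) this yields
    L^1 -> L^q for q < n / (n - 2 s). In the range 1 < p < q < oo, take
    b = n (1/p - 1/q) <= 2 s and prove the Hardy-Littlewood-Sobolev inequality
    for the bilinear form of f in L^p and g in L^P, 1/P = 1 - 1/q, both of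
    norm 1 (Hpar_bilinear_le). Split the domain according to whether
    g(x)^P <= f(z)^p or not. In the first part g is bounded by
    B = f(z)^(p/P), and a function of height B and norm 1 has its K-integral
    bounded by C B^(1 - P b/n) (Hpar_int_bounded_Lp_le); the exponents are
    such that multiplication by f(z) leaves C f(z)^p, which is integrable. The
    second part is symmetric.

    Unboundedness. For t ~ delta^2 the heat kernel is at least c delta^(-n) on
    the cube of size delta around 0, so K >= c delta^(2s-n) there
    (Hpar_kernel_ge). Tested against indicators of small cubes this excludes
    L^1 -> L^oo, and L^1 -> L^q for q >= n / (n - 2 s), at the endpoint by a
    logarithmic divergence, that is, one unit of mass per dyadic scale. For
    1 < p <= n / (2 s), truncations of |z|^(-2s) to N dyadic scales have L^p
    norm O(N^(1/p)), and images of size N near 0. *)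

(** * Powers, exponentials and hyperbolic functions *)

Section scalar_estimates.
Context {R : realType}.
Implicit Types (a b c t u x : R).

Lemma ler_powR2r a x y : 0 <= a -> 0 <= x -> x <= y -> x `^ a <= y `^ a.
Proof.
by move=> a0 x0 xy; apply: ge0_ler_powR => //; rewrite nnegrE// (le_trans x0).
Qed.

Lemma ler_powRN2r a x y : 0 <= a -> 0 < x -> x <= y -> y `^ (- a) <= x `^ (- a).
Proof.
move=> a0 x0 xy; rewrite !powRN lef_pV2 ?posrE ?powR_gt0//; last first.
  exact: lt_le_trans xy.
by apply: ler_powR2r => //; exact: ltW.
Qed.

Lemma powR_expRN_bounded a c : 0 <= a -> 0 < c ->
  exists2 C, 0 < C & forall t, 0 <= t -> t `^ a * expR (- (c * t)) <= C.
Proof.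
rewrite le_eqVlt => /predU1P[<- c0|a0 c0].
  exists 1 => // t t0; rewrite powRr0 mul1r expR_le1 oppr_le0.
  by rewrite mulr_ge0// ltW.
exists ((a / c) `^ a); first by rewrite powR_gt0// divr_gt0.
move=> t t0; rewrite expRN ler_pdivrMr ?expR_gt0//.
have -> : expR (c * t) = expR (c * t / a) `^ a.
  by rewrite -expRM divfK ?gt_eqF.
have ac : 0 < a / c by rewrite divr_gt0.
rewrite -powRM ?expR_ge0 ?(ltW ac)//.
apply: ler_powR2r; first exact: ltW.
  by [].
have -> : t = a / c * (c * t / a) by field; rewrite !gt_eqF.
rewrite ler_wpM2l ?(ltW ac)//.
have := expR_ge1Dx (c * t / a); set y := c * t / a => h.
rewrite (_ : c * (a / c * y) / a = y); last by field; rewrite !gt_eqF.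
lra.
Qed.

(** In these bounds for hyperbolic functions only the orders of growth matter:
    the constants are what 1 + u <= e^u gives. *)
Lemma sinh_double_ge t : 0 <= t -> t * expR t / 2 <= sinh (2 * t).
Proof.
move=> t0; rewrite /sinh ler_pM2r ?invr_gt0//.
have -> : 2 * t = t + t by ring.
have h1 := expR_ge1Dx t; have h2 := expR_gt0 t.
have h3 : expR (- (t + t)) <= expR t.
  by rewrite ler_expR; lra.
have h4 : expR (- (t + t)) <= 1 by rewrite expR_le1; lra.
rewrite expRD; nra.
Qed.

Lemma sinh_double_le t : 0 <= t -> t <= 2 -> sinh (2 * t) <= 2 * expR 4 * t.
Proof.
move=> t0 t2; rewrite /sinh ler_pdivrMr//.
have -> : - (2 * t) = 2 * t + - (4 * t) by ring.
rewrite [X in _ - X]expRD.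
have h1 := expR_ge1Dx (- (4 * t)).
have h2 : expR (2 * t) <= expR 4 by rewrite ler_expR; lra.
have h3 := expR_gt0 (2 * t).
nra.
Qed.

Lemma sinh_gt0 t : 0 < t -> 0 < sinh t.
Proof. by move=> t0; rewrite divr_gt0// subr_gt0 ltr_expR; lra. Qed.

Lemma cosh_gt0 t : 0 < cosh t.
Proof. by rewrite divr_gt0// addr_gt0 ?expR_gt0. Qed.

(** The double-angle formula coth 2t = (coth t + tanh t) / 2 turns the
    coefficient of |x - x'|^2 into coth t. *)
Lemma coth_double_sub_tanh t : 0 < t -> 2 * coth (2 * t) - tanh t = coth t.
Proof.
move=> t0; have := sinh_gt0 t0; have := cosh_gt0 t.
have := @sinh_gt0 (2 * t); rewrite mulr_gt0// => /(_ isT).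
rewrite /coth /tanh /cosh /sinh (_ : 2 * t = t + t); last by ring.
rewrite !opprD !expRD !expRN; have := expR_gt0 t; set e := expR t => e0 h1 h2 h3.
have e4 : e * e * (e * e) - 1 != 0.
  apply: contraTneq h1 => h; rewrite -invfM (_ : (_ - _) / 2 = (e * e * (e * e) - 1) / (2 * (e * e))).
    by rewrite h mul0r ltxx.
  by field; rewrite gt_eqF.
have e2 : e * e - 1 != 0.
  apply: contraTneq h3 => h; rewrite (_ : (_ - _) / 2 = (e * e - 1) / (2 * e)).
    by rewrite h mul0r ltxx.
  by field; rewrite gt_eqF.
have e3 : e * e + 1 != 0 by rewrite gt_eqF// addr_gt0// mulr_gt0.
field.
by rewrite e2 e3 e4 gt_eqF.
Qed.

Lemma coth_ge t : 0 < t -> 1 / (2 * t) <= coth t.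
Proof.
move=> t0; rewrite /coth ler_pdivlMr ?sinh_gt0// mul1r mulrC ler_pdivrMr ?mulr_gt0//.
rewrite /sinh /cosh.
have := expR_ge1Dx (- (2 * t)); rewrite (_ : - (2 * t) = - t - t); last by ring.
have e0 := expR_gt0 t; have e1 := expR_gt0 (- t); have e := expRxMexpNx_1 t.
rewrite expRD; set u := expR t in e0 e *; set v := expR (- t) in e1 e *.
move=> h; have : u * (1 + (- t - t)) <= u * (v * v) by rewrite ler_pM2l.
rewrite mulrA e mul1r; nra.
Qed.

Lemma tanh_le1 t : 0 <= t -> 0 <= tanh t <= 1.
Proof.
move=> t0; rewrite /tanh divr_ge0 ?(ltW (cosh_gt0 t))//=; last first.
  by rewrite divr_ge0// subr_ge0 ler_expR; lra.
rewrite ler_pdivrMr ?cosh_gt0// mul1r /sinh /cosh ler_pM2r ?invr_gt0//.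
by have := expR_gt0 (- t); lra.
Qed.

Lemma coth_le t : 0 < t -> t <= 2 -> t * coth t <= expR 4.
Proof.
move=> t0 t2; rewrite /coth mulrA ler_pdivrMr ?sinh_gt0// /sinh /cosh !mulrA.
rewrite ler_pM2r ?invr_gt0//.
have e0 := expR_gt0 t; have e1 := expR_gt0 (- t); have e := expRxMexpNx_1 t.
have h := expR_ge1Dx (2 * t); have h4 : expR (2 * t) <= expR 4 by rewrite ler_expR; lra.
have h5 : 5 <= expR 4 :> R by have := @expR_ge1Dx R 4; lra.
rewrite (_ : 2 * t = t + t) ?expRD in h h4; last by ring.
set u := expR t in e0 e h h4 *; set v := expR (- t) in e1 e *; set E := expR 4 in h4 h5 *.
suff : v * (t * (u * u + 1)) <= v * (E * (u * u - 1)).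
  rewrite (_ : v * (t * _) = t * (u * (u * v) + v)); last by ring.
  rewrite (_ : v * (E * _) = E * (u * (u * v) - v)); last by ring.
  by rewrite e !mulr1.
rewrite ler_pM2l//; nra.
Qed.

End scalar_estimates.

(** * Integrals over the half-line and positivity of Gamma *)

Section line_integrals.
Context {R : realType}.
Implicit Types (a b c t u x : R).
Local Notation mu := (@lebesgue_measure R).

Lemma is_derive_shift_powR (m a t : R) : 0 < m + t ->
  is_derive t 1 (fun u => (m + u) `^ a) (a * (m + t) `^ (a - 1)).
Proof.
move=> mt.
have h : is_derive t 1 (fun u => m + u) 1.
  by apply: is_derive_eq; rewrite add0r mulr1.
have h2 := @is_derive1_powR R a (m + t) mt.
have := @is_derive1_comp R (fun u => u `^ a) (fun u => m + u) t _ _ h2 h.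
by rewrite mulr1.
Qed.

Lemma cvg_powRN_pinfty (m g : R) : 0 < g ->
  (m + t) `^ (- g) @[t --> +oo%R] --> (0 : R).
Proof.
move=> g0; apply/cvgrPdist_le => e e0.
exists (e `^ (- g^-1) - m); split; first exact: num_real.
move=> t /ltW h.
have eg : 0 < e `^ (- g^-1) by rewrite powR_gt0.
rewrite sub0r normrN ger0_norm ?powR_ge0//.
apply: (@le_trans _ _ ((e `^ (- g^-1)) `^ (- g))).
  by apply: ler_powRN2r; [exact: ltW|exact: eg|lra].
by rewrite -powRrM mulrNN mulVf ?gt_eqF// powRr1// ltW.
Qed.

Lemma integral_shift_powRN (m g : R) : 0 < m -> 0 < g ->
  (\int[mu]_(t in `[0%R, +oo[) ((m + t) `^ (- g - 1))%:E = (m `^ (- g) / g)%:E)%E.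
Proof.
move=> m0 g0.
pose F t := - g^-1 * (m + t) `^ (- g).
have dF t : 0 <= t -> is_derive t 1 F ((m + t) `^ (- g - 1)).
  move=> t0; have mt : 0 < m + t by rewrite ltr_wpDr.
  have h := is_derive_shift_powR (- g) mt.
  rewrite /F; apply: is_derive_eq.
  rewrite /GRing.scale /=. rewrite mulrA mulrNN mulVf ?mul1r ?gt_eqF//.
rewrite (@ge0_continuous_FTC2y R _ F 0 0).
- by rewrite /F addr0 sub0e -EFinN mulNr opprK mulrC.
- by move=> x _; exact: powR_ge0.
- apply: continuous_in_subspaceT => x; rewrite inE /= in_itv /= andbT => x0.
  have mx : 0 < m + x by rewrite ltr_wpDr.
  by apply: differentiable_continuous; apply/derivable1_diffP;
     have h := is_derive_shift_powR (- g - 1) mx; exact: ex_derive.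
- rewrite -(mulr0 (- g^-1)); apply: cvgMr => //; exact: cvg_powRN_pinfty.
- by move=> x x0; have h := dF x (ltW x0); exact: ex_derive.
- apply: cvg_at_right_filter; have h := dF 0 (lexx _).
  by apply: differentiable_continuous; apply/derivable1_diffP; exact: ex_derive.
- move=> x; rewrite in_itv /= andbT => x0; rewrite derive1E.
  by have h := dF x (ltW x0); rewrite derive_val.
Qed.


Lemma measurable_powR_pred (s : R) (D : set (measurableTypeR R)) :
  measurable_fun D (EFin \o (fun t : R => t `^ (s - 1))).
Proof. by apply/measurable_EFinP/measurable_funTS; exact: measurable_powR. Qed.

Lemma measurable_shift_powR (m a : R) (D : set (measurableTypeR R)) :
  measurable_fun D (fun t => (m + t) `^ a).
Proof.
apply: measurable_funTS; apply: (measurableT_comp (measurable_powR _)).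
by apply: measurable_funD; [exact: measurable_cst|exact: measurable_id].
Qed.

(** For s < 1 the integrand blows up at 0, hence the exhaustion of ]0, 1] by
    the intervals [1/(k + 1), 1], on which it is continuous. *)
Lemma integral_powR_itv01_le (s : R) : 0 < s ->
  (\int[mu]_(t in `]0%R, 1%R]) (t `^ (s - 1))%:E <= (s^-1)%:E)%E.
Proof.
move=> s0.
pose F (k : nat) : set (measurableTypeR R) := `[(k.+1%:R)^-1, 1]%classic.
have UF : \bigcup_k F k = `]0, 1]%classic.
  apply/seteqP; split => [x [k _]|x]; rewrite /F /= !in_itv /=.
    by move=> /andP[kx ->]; rewrite andbT (lt_le_trans _ kx).
  move=> /andP[x0 x1]; exists (Num.truncn x^-1) => //; rewrite /= in_itv/= x1 andbT.
  by rewrite invf_ple ?posrE// ltW// truncnS_gt.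
have ndF : nondecreasing_seq F.
  move=> n m nm; rewrite subsetEset => x; rewrite /F/= !in_itv/= => /andP[h ->].
  by rewrite andbT (le_trans _ h)// lef_pV2 ?posrE// ler_nat.
rewrite -UF.
have cF : (\int[mu]_(x in F i) (x `^ (s - 1))%:E @[i --> \oo] -->
   \int[mu]_(x in \bigcup_i F i) (x `^ (s - 1))%:E)%E.
  have := @ge0_nondecreasing_set_cvg_integral _ (measurableTypeR R) R F (fun t : measurableTypeR R => (t `^ (s - 1))%:E) mu ndF; apply=> [i|i|i x _].
  - exact: measurable_itv.
  - exact: measurable_powR_pred.
  - by rewrite lee_fin powR_ge0.
rewrite -(cvg_lim _ cF)//; apply: lime_le; first by apply/cvg_ex; eexists; exact: cF.
near=> k.
have k1 : (k.+1%:R)^-1 < 1 :> R by rewrite invf_lt1// ltr1n; near: k; exists 1%N.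
have k0 : 0 < (k.+1%:R)^-1 :> R by rewrite invr_gt0.
have dp x : 0 < x -> is_derive x 1 (fun u : R => s^-1 * u `^ s) (x `^ (s - 1)).
  move=> x0; have h := @is_derive1_powR R s x x0; apply: is_derive_eq.
  by rewrite /GRing.scale /= mulrA mulVf ?mul1r ?gt_eqF.
have cts x : 0 < x -> {for x, continuous (fun u : R => s^-1 * u `^ s)}.
  move=> x0; have h := dp x x0.
  by apply: differentiable_continuous; apply/derivable1_diffP; exact: ex_derive.
rewrite (@continuous_FTC2 _ _ (fun u => s^-1 * u `^ s))//.
- rewrite powR1 mulr1 lee_subel_addr// leeDl// lee_fin.
  by rewrite mulr_ge0 ?powR_ge0// invr_ge0 ltW.
- apply: continuous_in_subspaceT => x; rewrite inE/= in_itv/= => /andP[kx _].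
  have x0 : 0 < x by exact: lt_le_trans kx.
  apply: differentiable_continuous; apply/derivable1_diffP.
  by have h := @is_derive1_powR R (s - 1) x x0; exact: ex_derive.
- split.
  + move=> x; rewrite in_itv/= => /andP[kx _].
    by have h := dp x (lt_trans k0 kx); exact: ex_derive.
  + by apply: cvg_at_right_filter; exact: cts.
  + by apply: cvg_at_left_filter; exact: cts.
- move=> x; rewrite in_itv/= => /andP[kx _]; rewrite derive1E.
  by have h := dp x (lt_trans k0 kx); rewrite derive_val.
Unshelve. all: by end_near. Qed.

(** Gamma is the finite part of an integral, so its positivity includes
    convergence: t^(s - 1) dominates on ]0, 1] and C (1 + t)^-2 beyond 1. *)
Lemma Gamma_gt0 (s : R) : 0 < s -> 0 < Gamma s.
Proof.
move=> s0; rewrite /Gamma /Rintegral.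
set f : R -> R := fun t => t `^ (s - 1) * expR (- t).
have f0 t : 0 <= f t by rewrite mulr_ge0 ?powR_ge0 ?expR_ge0.
have mf (D : set (measurableTypeR R)) : measurable_fun D (EFin \o f).
  apply/measurable_EFinP/measurable_funTS; apply: measurable_funM.
    exact: measurable_powR.
  by apply: measurableT_comp; [exact: measurable_expR|exact: measurable_funN].
have [C C0 hC] : exists2 C, 0 < C & forall t, 0 <= t -> (1 + t) `^ (s + 2) * expR (- t) <= C.
  have [C C0 hC] := @powR_expRN_bounded R (s + 2) 1 (addr_ge0 (ltW s0) (ler0n _ _)) ltr01.
  exists (C * expR 1); first by rewrite mulr_gt0 ?expR_gt0.
  move=> t t0; have := hC (1 + t) (addr_ge0 ler01 t0).
  rewrite mul1r (_ : - t = - (1 + t) + 1); last by lra.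
  by rewrite [X in _ -> _ * X <= _]expRD mulrA ler_pM2r ?expR_gt0.
have split01 : `]0%R, +oo[%classic = `]0%R, 1%R] `|` `]1%R, +oo[ :> set R.
  by rewrite -itv_bndbnd_setU// ?bnd_simp.
have ub : (\int[mu]_(t in `]0%R, +oo[) (f t)%:E < +oo)%E.
  rewrite split01 ge0_integral_setU//=; last 2 first.
  - by move=> x _; rewrite lee_fin.
  - apply/disj_setPS => x /= []; rewrite !in_itv/= => /andP[_ x1].
    by rewrite andbT ltNge x1.
  rewrite lte_add_pinfty//.
    apply: (@le_lt_trans _ _ (s^-1)%:E); last exact: ltry.
    apply: le_trans (integral_powR_itv01_le s0).
    apply: ge0_le_integral => //.
    - by move=> x _; rewrite lee_fin.
    - exact: measurable_powR_pred.
    - move=> x; rewrite /= in_itv/= => /andP[x0 _]; rewrite lee_fin ler_piMr ?powR_ge0//.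
      by rewrite expR_le1 oppr_le0 ltW.
  apply: (@le_lt_trans _ _ (\int[mu]_(t in `]1%R, +oo[) (C%:E * ((1 + t) `^ (- 1 - 1))%:E))%E).
    apply: ge0_le_integral => //.
    - by move=> x _; rewrite lee_fin.
    - apply/measurable_EFinP; apply: measurable_funM => //.
      exact: measurable_shift_powR.
    - move=> x; rewrite /= in_itv/= andbT => x1; rewrite -EFinM lee_fin.
      have x0 : 0 < x by lra.
      have h2 : 0 < (1 + x) `^ 2 by rewrite powR_gt0//; lra.
      rewrite (_ : -1 - 1 = - 2) ?powRN; last by lra.
      rewrite ler_pdivlMr//; apply: le_trans (hC x (ltW x0)).
      rewrite /f mulrAC ler_wpM2r ?expR_ge0// [leRHS]powRD; last first.
        by apply/implyP => _; rewrite gt_eqF//; lra.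
      rewrite ler_wpM2r ?powR_ge0//; apply: (@le_trans _ _ (x `^ s)).
        by rewrite ler_powR ?ltW//; lra.
      by apply: ler_powR2r; lra.
  rewrite ge0_integralZl//=; last 3 first.
  - by apply/measurable_EFinP; exact: measurable_shift_powR.
  - by move=> x _; rewrite lee_fin powR_ge0.
  - by rewrite lee_fin ltW.
  apply: lte_mul_pinfty => //; first by rewrite lee_fin ltW.
  apply: (@le_lt_trans _ _ (\int[mu]_(t in `[0%R, +oo[) ((1 + t) `^ (- 1 - 1))%:E)%E).
    apply: ge0_subset_integral => //.
    - by apply/measurable_EFinP; exact: measurable_shift_powR.
    - by move=> x _; rewrite lee_fin powR_ge0.
    - by move=> x; rewrite /= !in_itv/= !andbT => x1; exact: le_trans ler01 (ltW x1).
  by rewrite integral_shift_powRN// ltry.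
apply: fine_gt0; rewrite ub andbT.
have [c c0 hc] : exists2 c, 0 < c & forall t, 1 <= t -> t <= 2 -> c <= f t.
  exists (expR (- 2) * 2 `^ (- `|s - 1|)); first by rewrite mulr_gt0 ?expR_gt0 ?powR_gt0.
  move=> t t1 t2; rewrite /f mulrC ler_pM ?powR_ge0 ?expR_ge0//; last by rewrite ler_expR lerN2.
  apply: (@le_trans _ _ (t `^ (- `|s - 1|))).
    by apply: ler_powRN2r => //; lra.
  by rewrite ler_powR// lerNl ler_normr lexx orbT.
apply: (@lt_le_trans _ _ (\int[mu]_(t in `[1%R, 2%R]) c%:E)%E).
  rewrite integral_cst//= lebesgue_measure_itv /= lte_fin ltr1n -EFinD -EFinM lte_fin.
  by rewrite mulr_gt0//; lra.
apply: (@le_trans _ _ (\int[mu]_(t in `[1%R, 2%R]) (f t)%:E)%E).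
  apply: ge0_le_integral => //.
  - by move=> x _; rewrite lee_fin ltW.
  - by move=> x; rewrite /= in_itv/= => /andP[x1 x2]; rewrite lee_fin hc.
apply: ge0_subset_integral => //.
- by move=> x _; rewrite lee_fin.
- by move=> x; rewrite /= !in_itv/= andbT => /andP[x1 _]; exact: lt_le_trans x1.
Qed.
End line_integrals.

(** * Cubes and their Lebesgue measure *)

Section cubes.
Context {R : realType}.
Local Notation rT := (measurableTypeR R).

Definition box n (x : n.-tuple rT) (r : R) : set (n.-tuple rT) :=
  [set y | forall i, `|tnth x i - tnth y i| <= r].

Lemma measurable_box n (x : n.-tuple rT) (r : R) : measurable (box x r).
Proof.
have -> : box x r = \bigcap_(i in [set: 'I_n]) ((fun y => tnth y i) @^-1` `[tnth x i - r, tnth x i + r]).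
  apply/seteqP; split => y /= h i; first move=> _; last first.
    by have := h i Logic.I; rewrite /= in_itv/= ler_distlC.
  by rewrite /= in_itv/= -ler_distlC.
apply: fin_bigcap_measurable => // i _; rewrite -[X in measurable X]setTI.
by apply: measurable_tnth => //; exact: measurable_itv.
Qed.

Lemma centered_itvE (a r : R) :
  [set u : rT | `|a - u| <= r] = `[a - r, a + r]%classic.
Proof. by apply/seteqP; split => u /=; rewrite in_itv/= ler_distlC. Qed.

Lemma measurable_centered_itv (a r : R) :
  measurable [set u : rT | `|a - u| <= r].
Proof. by rewrite centered_itvE; exact: measurable_itv. Qed.

Lemma lebesgue_itv_centered (a r : R) : 0 <= r ->
  lebesgue_measure [set u : rT | `|a - u| <= r] = (2 * r)%:E.
Proof.
move=> r0; rewrite centered_itvE lebesgue_measure_itv/= lte_fin -EFinD; case: ifPn => h.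
  by congr EFin; ring.
congr EFin; have -> : r = 0 by apply/eqP; rewrite eq_le r0 andbT; move: h; rewrite -leNgt; lra.
by rewrite mulr0.
Qed.

Lemma lebesgue_tuple_box n (x : n.-tuple rT) (r : R) : 0 <= r ->
  lebesgue_tuple n (box x r) = ((2 * r) ^+ n)%:E.
Proof.
move=> r0; elim: n x => [|n IH] x.
  rewrite /= diracE mem_set ?expr0//= => i; by case: i.
case/tupleP: x => a x; rewrite [LHS]/= /lebesgue_cons /pushforward.
have -> : consT (n:=n) @^-1` box [tuple of a :: x] r =
    [set u : rT | `|a - u| <= r] `*` box x r.
  apply/seteqP; split => [[u y] /= h|[u y] /= [h1 h2] i].
    split; first by have := h ord0; rewrite !tnth0.
    by move=> i; have := h (lift ord0 i); rewrite !tnthS.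
  by case: (unliftP ord0 i) => [j|] ->; rewrite ?tnthS ?tnth0.
rewrite product_measure1E//; last exact: measurable_box.
  by rewrite exprS EFinM; congr (_ * _)%E; [exact: lebesgue_itv_centered|exact: IH].
exact: measurable_centered_itv.
Qed.

Variable d : nat.
Local Notation mu := (@lebesgue_space R d).

(** Cubes, unlike balls, have a measure that the product structure computes;
    for upper and lower bounds up to constants they serve equally well. *)
Definition cube (z : space R d) (r : R) : set (space R d) :=
  [set u : rT | `|(z.1 : R) - u| <= r] `*` box z.2 r.

Lemma measurable_cube z r : measurable (cube z r).
Proof.
by apply: measurableX; [exact: measurable_centered_itv|exact: measurable_box].
Qed.

Lemma lebesgue_cube z r : 0 <= r -> mu (cube z r) = ((2 * r) ^+ d.+1)%:E.
Proof.
move=> r0; rewrite /lebesgue_space /cube product_measure1E.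
- by rewrite exprS EFinM; congr (_ * _)%E;
    [exact: lebesgue_itv_centered|exact: lebesgue_tuple_box].
- exact: measurable_centered_itv.
- exact: measurable_box.
Qed.

Lemma subset_cube z r r' : r <= r' -> cube z r `<=` cube z r'.
Proof.
by move=> rr z' [/= h1 h2]; split => /= [|i]; [exact: le_trans rr|exact: le_trans (h2 i) rr].
Qed.

Definition sqnorm_sub (z z' : space R d) : R :=
  ((z.1 : R) - (z'.1 : R)) ^+ 2 + sqdist z.2 z'.2.

Lemma sqdist_ge0 (x y : d.-tuple R) : 0 <= sqdist x y.
Proof. by apply: sumr_ge0 => i _; exact: sqr_ge0. Qed.

Lemma sqnorm_sub_ge0 z z' : 0 <= sqnorm_sub z z'.
Proof. by rewrite addr_ge0 ?sqr_ge0 ?sqdist_ge0. Qed.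

Lemma sqnorm_sub_cube z z' r : 0 <= r -> sqnorm_sub z z' <= r ^+ 2 -> cube z r z'.
Proof.
move=> r0 h; have h2 := sqdist_ge0 z.2 z'.2; split => [|i] /=.
  rewrite -ler_sqr ?nnegrE// real_normK ?num_real//.
  by apply: le_trans h; rewrite lerDl.
rewrite -ler_sqr ?nnegrE// real_normK ?num_real//.
apply: le_trans h; rewrite /sqnorm_sub /sqdist (bigD1 i)//= addrCA lerDl.
by rewrite addr_ge0 ?sqr_ge0// sumr_ge0// => j _; exact: sqr_ge0.
Qed.

Lemma cube_sqdist z z' r : cube z r z' ->
  ((z.1 : R) - (z'.1 : R)) ^+ 2 <= r ^+ 2 /\ sqdist z.2 z'.2 <= d%:R * r ^+ 2.
Proof.
move=> [/= h1 h2]; have r0 : 0 <= r by exact: le_trans h1.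
split; first by rewrite -[leLHS]real_normK ?num_real// ler_sqr ?nnegrE.
rewrite /sqdist mulr_natl -[X in _ *+ X]card_ord -sumr_const ler_sum// => i _.
by rewrite -[leLHS]real_normK ?num_real// ler_sqr ?nnegrE.
Qed.

End cubes.

(** * Measurability and symmetry of the kernel *)

Section kernel_measurability.
Context {R : realType} {d : nat}.
Local Notation rT := (measurableTypeR R).
Local Notation sp := (space R d).
Local Notation mu := (@lebesgue_space R d).

Lemma measurable_invr : measurable_fun [set: rT] (fun x : rT => x^-1).
Proof.
(* (x^2)^-1 is a real power of x^2, also at x = 0 where both sides vanish *)
have -> : (fun x : rT => x^-1) = (fun x : rT => x * (x ^+ 2) `^ (-1)).
  apply/funext => x; rewrite powR_inv1 ?sqr_ge0//.
  have [->|x0] := eqVneq x 0; first by rewrite invr0 mul0r.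
  by field.
apply: measurable_funM; first exact: measurable_id.
apply: (measurableT_comp (measurable_powR _)).
by apply: measurable_funX; exact: measurable_id.
Qed.

Section compositions.
Context d' (T : measurableType d') (f : T -> rT).
Hypothesis mf : measurable_fun [set: T] f.

Lemma measurable_fun_sinh : measurable_fun [set: T] (fun x => sinh (f x)).
Proof.
apply: measurable_funM; last exact: measurable_cst.
apply: measurable_funB; apply: (measurableT_comp (@measurable_expR R)) => //.
exact: measurable_funN.
Qed.

Lemma measurable_fun_cosh : measurable_fun [set: T] (fun x => cosh (f x)).
Proof.
apply: measurable_funM; last exact: measurable_cst.
apply: measurable_funD; apply: (measurableT_comp (@measurable_expR R)) => //.
exact: measurable_funN.
Qed.

Lemma measurable_fun_tanh : measurable_fun [set: T] (fun x => tanh (f x)).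
Proof.
apply: measurable_funM; first exact: measurable_fun_sinh.
by apply: (measurableT_comp measurable_invr); exact: measurable_fun_cosh.
Qed.

Lemma measurable_fun_coth : measurable_fun [set: T] (fun x => coth (f x)).
Proof.
apply: measurable_funM; first exact: measurable_fun_cosh.
by apply: (measurableT_comp measurable_invr); exact: measurable_fun_sinh.
Qed.

End compositions.

Lemma measurable_heat_kernel d' (T : measurableType d') (t : T -> rT)
    (z z' : T -> sp) : measurable_fun setT t -> measurable_fun setT z ->
  measurable_fun setT z' ->
  measurable_fun [set: T] (fun w => heat_kernel (t w) (z w) (z' w)).
Proof.
move=> mt mz mz'.
have mfst (u : T -> sp) : measurable_fun setT u ->
    measurable_fun [set: T] (fun w => ((u w).1 : rT)).
  by move=> mu'; exact: (measurableT_comp measurable_fst mu').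
have mnth (u : T -> sp) i : measurable_fun setT u ->
    measurable_fun [set: T] (fun w => (tnth (u w).2 i : rT)).
  move=> mu'; apply: (measurableT_comp (@measurable_tnth _ rT d i)).
  exact: (measurableT_comp measurable_snd mu').
have m2t : measurable_fun setT (fun w => 2 * t w).
  by apply: measurable_funM => //; exact: measurable_cst.
rewrite /heat_kernel; apply: measurable_funM; first apply: measurable_funM.
- by apply: measurable_funM; [exact: measurable_cst|
     exact: (measurableT_comp (measurable_powR _) mt)].
- by apply: (measurableT_comp (measurable_powR _)); exact: measurable_fun_sinh.
apply: (measurableT_comp (@measurable_expR R)).
apply: measurable_funB; first apply: measurable_funB.
- apply: measurable_funM.
    apply: measurable_funM; first exact: measurable_cst.
    apply: measurable_funB; last exact: measurable_fun_tanh.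
    by apply: measurable_funM; [exact: measurable_cst|exact: measurable_fun_coth].
  by apply: measurable_sum => i; apply: measurable_funX; apply: measurable_funB; exact: mnth.
- apply: measurable_funM.
    by apply: measurable_funM; [exact: measurable_fun_tanh|exact: measurable_cst].
  by apply: measurable_sum => i; apply: measurable_funX; apply: measurable_funD; exact: mnth.
- apply: measurable_funM.
    by apply: measurable_funX; apply: measurable_funB; exact: mfst.
  apply: (measurableT_comp measurable_invr).
  by apply: measurable_funM => //; exact: measurable_cst.
Qed.

Lemma heat_kernel_ge0 (t : R) (z z' : sp) : 0 <= heat_kernel t z z'.
Proof. by rewrite /heat_kernel !mulr_ge0 ?powR_ge0 ?expR_ge0. Qed.

Lemma heat_kernelC (t : R) (z z' : sp) : heat_kernel t z z' = heat_kernel t z' z.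
Proof.
rewrite /heat_kernel; congr (_ * expR _).
have -> : sqdist z.2 z'.2 = sqdist z'.2 z.2.
  by apply: eq_bigr => i _; rewrite -sqrrN opprB.
have -> : sqsum z.2 z'.2 = sqsum z'.2 z.2.
  by apply: eq_bigr => i _; rewrite addrC.
by rewrite -[in LHS]sqrrN opprB.
Qed.

Variable s : R.
Hypothesis s0 : 0 < s.

Local Notation K := (@Hpar_kernel R d s).

Lemma Hpar_kernelC z z' : K z z' = K z' z.
Proof.
rewrite /Hpar_kernel; congr (_ * _)%E; apply: eq_integral => t _.
by rewrite heat_kernelC.
Qed.

Lemma Hpar_kernel_ge0 z z' : (0 <= K z z')%E.
Proof.
rewrite mule_ge0// ?lee_fin ?invr_ge0 ?(ltW (Gamma_gt0 s0))//.
by apply: integral_ge0 => t _; rewrite lee_fin mulr_ge0 ?powR_ge0 ?heat_kernel_ge0.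
Qed.

(** Joint measurability of the kernel, which makes Tonelli's theorem available
    for all the double integrals below. *)
Lemma measurable_Hpar_kernel2 :
  measurable_fun [set: sp * sp] (fun w => K w.1 w.2).
Proof.
rewrite /Hpar_kernel; apply: measurable_funeM.
under eq_fun do rewrite integral_mkcond.
pose f (p : (sp * sp) * rT) : \bar R :=
  ((fun t : rT => (t `^ (s - 1) * heat_kernel t p.1.1 p.1.2)%:E) \_ `]0%R, +oo[) p.2.
apply: (@measurable_fun_fubini_tonelli_F _ _ (sp * sp)%type rT R lebesgue_measure f).
  rewrite /f; under eq_fun do rewrite patchE.
  apply: measurable_fun_ifT.
  - have : measurable_fun setT (fun p : (sp * sp) * rT => 0 < p.2).
      by apply: measurable_fun_ltr; [exact: measurable_cst|exact: measurable_snd].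
    congr measurable_fun; apply/funext => p.
    by apply/idP/idP; rewrite ?mem_setE in_itv/= andbT.
  - apply/measurable_EFinP; apply: measurable_funM.
      exact: (measurableT_comp (measurable_powR _) measurable_snd).
    apply: measurable_heat_kernel; first exact: measurable_snd.
    + exact: (measurableT_comp measurable_fst measurable_fst).
    + exact: (measurableT_comp measurable_snd measurable_fst).
  - exact: measurable_cst.
move=> p; rewrite /f; apply: erestrict_ge0 => t _.
by rewrite lee_fin mulr_ge0 ?powR_ge0 ?heat_kernel_ge0.
Qed.

Lemma measurable_Hpar_kernel z : measurable_fun [set: sp] (K z).
Proof.
apply: (measurableT_comp measurable_Hpar_kernel2 (g := fun z' => (z, z'))).
exact: measurable_pair1.
Qed.

End kernel_measurability.

(** * Upper bounds for the kernel *)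

Section kernel_upper_bound.
Context {R : realType} {d : nat}.
Local Notation rT := (measurableTypeR R).
Local Notation sp := (space R d).

(** A Gaussian in |z - z'| of variance t, with an exponential gain in time:
    coth t >= 1/(2t) gives the Gaussian and sinh 2t >= t e^t / 2 the gain,
    which reflects that the spectrum of -Delta + |x|^2 starts at d > 0. *)
Lemma heat_kernel_le : exists2 C : R, 0 < C & forall t (z z' : sp), 0 < t ->
  heat_kernel t z z' <= C * t `^ (- (d.+1%:R / 2)) * expR (- (d%:R / 2 * t))
                        * expR (- (sqnorm_sub z z' / (8 * t))).
Proof.
set c0 : R := 2 `^ (- (d.+2%:R / 2)) * pi `^ (- (d.+1%:R / 2)).
have c00 : 0 < c0 by rewrite mulr_gt0// powR_gt0// pi_gt0.
exists (c0 * 2^-1 `^ (- (d%:R / 2))); first by rewrite mulr_gt0// powR_gt0// invr_gt0.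
move=> t z z' t0; rewrite /heat_kernel -/c0.
apply: ler_pM; rewrite ?expR_ge0//.
- by rewrite !mulr_ge0 ?powR_ge0 ?(ltW c00).
- have d2 : 0 <= d%:R / 2 :> R by rewrite divr_ge0.
  have h : sinh (2 * t) `^ (- (d%:R / 2)) <= (2^-1 * (t * expR t)) `^ (- (d%:R / 2)).
    apply: ler_powRN2r => //; first by rewrite !mulr_gt0 ?expR_gt0 ?invr_gt0.
    by rewrite mulrC; apply: sinh_double_ge; exact: ltW.
  apply: le_trans (_ : c0 * t `^ (- (1 / 2)) * (2^-1 * (t * expR t)) `^ (- (d%:R / 2)) <= _).
    by rewrite ler_wpM2l// mulr_ge0 ?powR_ge0 ?(ltW c00).
  rewrite !powRM ?invr_ge0 ?mulr_ge0 ?expR_ge0 ?(ltW t0)// -expRM.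
  have -> : - (d.+1%:R / 2) = - (1 / 2) + - (d%:R / 2) :> R by rewrite -natr1; field.
  rewrite powRD; last by rewrite (gt_eqF t0) implybT.
  have -> : t * - (d%:R / 2) = - (d%:R / 2 * t) by ring.
  set A := 2^-1 `^ _; set B := t `^ (- (1 / 2)); set D := t `^ _; set F := expR _.
  have -> : c0 * B * (A * (D * F)) = c0 * A * (B * D) * F by ring.
  exact: lexx.
- rewrite ler_expR coth_double_sub_tanh//.
  have h1 := coth_ge t0; have /andP[h2 _] := tanh_le1 (ltW t0).
  have h3 : 0 <= sqsum z.2 z'.2 by apply: sumr_ge0 => i _; exact: sqr_ge0.
  have h4 := sqdist_ge0 z.2 z'.2.
  rewrite /sqnorm_sub.
  set A := sqdist _ _ in h4 *; set B := sqsum _ _ in h3 *; set r := _ ^+ 2.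
  have r0 : 0 <= r by exact: sqr_ge0.
  have e1 : (r + A) / (8 * t) = r / (4 * t) / 2 + 1 / 4 * (1 / (2 * t)) * A.
    by field; rewrite gt_eqF.
  have e2 : 0 <= r / (4 * t) by rewrite divr_ge0// mulr_ge0// ltW.
  have e3 : 0 <= tanh t / 4 * B by rewrite mulr_ge0// divr_ge0.
  have e4 : 1 / 4 * (1 / (2 * t)) * A <= 1 / 4 * coth t * A.
    by rewrite ler_wpM2r// ler_wpM2l.
  rewrite e1; lra.
Qed.

(** The bound (D + t)^(-g-1) has an explicit primitive in t, unlike the
    Gaussian t^(-g-1) e^(-D/8t), and has the same integral up to a constant. *)
Lemma heat_integrand_le (s b : R) : (1 <= d)%N -> b <= 2 * s -> b < d.+1%:R ->
  exists2 C : R, 0 < C & forall t (z z' : sp), 0 < t -> 0 < sqnorm_sub z z' ->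
    t `^ (s - 1) * heat_kernel t z z' <=
    C * (sqnorm_sub z z' + t) `^ (- ((d.+1%:R - b) / 2) - 1).
Proof.
move=> d1 bs bn; set g := (d.+1%:R - b) / 2.
have g0 : 0 < g by rewrite divr_gt0// subr_gt0.
have [C C0 hC] := heat_kernel_le.
have d20 : 0 < d%:R / 2 :> R by rewrite divr_gt0// ltr0n.
have sb0 : 0 <= 2 * s - b by rewrite subr_ge0.
have g1 : 0 <= g + 1 by rewrite addr_ge0// ltW.
have e8 : 0 < 1 / 8 :> R by rewrite divr_gt0.
have [C1 C10 hC1] := @powR_expRN_bounded R ((2 * s - b) / 2) (d%:R / 2)
  (divr_ge0 sb0 (ler0n _ 2)) d20.
have [C2 C20 hC2] := @powR_expRN_bounded R (g + 1) (1 / 8) g1 e8.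
exists (C * C1 * (C2 * expR (1 / 8))); first by rewrite !mulr_gt0 ?expR_gt0.
move=> t z z' t0; set D := sqnorm_sub z z' => D0.
have tn0 : (t == 0) = false by rewrite gt_eqF.
apply: le_trans (_ : t `^ (s - 1) * (C * t `^ (- (d.+1%:R / 2)) * expR (- (d%:R / 2 * t))
                        * expR (- (D / (8 * t)))) <= _).
  by rewrite ler_wpM2l ?powR_ge0//; exact: hC.
(* t^(s - 1 - n/2) = t^((2 s - b)/2) t^(-g-1): the first factor is absorbed
   by e^(-dt/2), the second goes with the Gaussian *)
have -> : t `^ (s - 1) * (C * t `^ (- (d.+1%:R / 2)) * expR (- (d%:R / 2 * t))
    * expR (- (D / (8 * t)))) =
  C * (t `^ ((2 * s - b) / 2) * expR (- (d%:R / 2 * t))) *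
    (t `^ (- g - 1) * expR (- (D / (8 * t)))).
  have e : t `^ (s - 1) * t `^ (- (d.+1%:R / 2)) = t `^ ((2 * s - b) / 2) * t `^ (- g - 1).
    rewrite -!powRD; try by rewrite tn0 implybT.
    by congr (_ `^ _); rewrite /g; field.
  transitivity (C * (t `^ (s - 1) * t `^ (- (d.+1%:R / 2))) * expR (- (d%:R / 2 * t))
     * expR (- (D / (8 * t)))); first by ring.
  by rewrite e; ring.
rewrite -[leRHS]mulrA; apply: ler_pM.
- by rewrite !mulr_ge0 ?powR_ge0 ?expR_ge0 ?(ltW C0).
- by rewrite mulr_ge0 ?powR_ge0 ?expR_ge0.
- by rewrite ler_pM2l//; apply: hC1; exact: ltW.
have Dt : 0 < D + t by rewrite addr_gt0.
pose u := (D + t) / t.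
have u0 : 0 < u by rewrite divr_gt0.
have Dtu : D + t = t * u by rewrite /u; field; rewrite gt_eqF.
have -> : - g - 1 = - (g + 1) by ring.
rewrite Dtu [in leRHS]powRM ?(ltW t0) ?(ltW u0)//.
have -> : - (D / (8 * t)) = - (1 / 8 * u) + 1 / 8 by rewrite /u; field; rewrite gt_eqF.
rewrite expRD -[leRHS]mulrA.
have := hC2 _ (ltW u0); rewrite powRN -ler_pdivlMl ?powR_gt0// => h.
rewrite [u `^ (- _)]powRN.
rewrite [leRHS](_ : _ = (t `^ (g + 1))^-1 * ((u `^ (g + 1))^-1 * C2 * expR (1 / 8))).
  by rewrite ler_wpM2l ?invr_ge0 ?powR_ge0// ler_wpM2r ?expR_ge0.
ring.
Qed.

(** The kernel is dominated, away from the diagonal, by every Riesz kernel of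
    order b <= 2 s: the factor e^(-dt/2) trades t^(s - 1) for t^(b/2 - 1). *)
Lemma Hpar_kernel_le (s b : R) : (1 <= d)%N -> 0 < s -> b <= 2 * s -> b < d.+1%:R ->
  exists2 C : R, 0 < C & forall z z' : sp, 0 < sqnorm_sub z z' ->
    (Hpar_kernel s z z' <= (C * sqnorm_sub z z' `^ (- ((d.+1%:R - b) / 2)))%:E)%E.
Proof.
move=> d1 s0 bs bn; have [C C0 hC] := heat_integrand_le d1 bs bn.
set g := (d.+1%:R - b) / 2 in hC *.
have g0 : 0 < g by rewrite divr_gt0// subr_gt0.
have G0 := Gamma_gt0 s0.
exists ((Gamma s)^-1 * (C / g)); first by rewrite mulr_gt0 ?invr_gt0// divr_gt0.
move=> z z' D0; rewrite /Hpar_kernel -mulrA EFinM lee_pmul2l ?lte_fin ?invr_gt0//.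
set D := sqnorm_sub z z' in D0 *.
have mh : measurable_fun [set: rT] (fun t => t `^ (s - 1) * heat_kernel t z z').
  apply: measurable_funM; first exact: measurable_powR.
  by apply: measurable_heat_kernel; [exact: measurable_id|exact: measurable_cst..].
have mD : measurable_fun [set: rT] (fun t => C * (D + t) `^ (- g - 1)).
  by apply: measurable_funM; [exact: measurable_cst|exact: measurable_shift_powR].
apply: (@le_trans _ _ (\int[lebesgue_measure]_(t in `]0%R, +oo[)
    (C * (D + t) `^ (- g - 1))%:E)%E).
  apply: ge0_le_integral => //.
  - by move=> t _; rewrite lee_fin mulr_ge0 ?powR_ge0 ?heat_kernel_ge0.
  - by apply/measurable_EFinP/measurable_funTS.
  - by apply/measurable_EFinP/measurable_funTS.
  - by move=> t; rewrite /= in_itv/= andbT => t0; rewrite lee_fin hC.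
apply: (@le_trans _ _ (\int[lebesgue_measure]_(t in `[0%R, +oo[)
    (C * (D + t) `^ (- g - 1))%:E)%E).
  apply: ge0_subset_integral => //.
  - by apply/measurable_EFinP/measurable_funTS.
  - by move=> t _; rewrite lee_fin mulr_ge0 ?powR_ge0// ltW.
  - by move=> t; rewrite /= !in_itv/= !andbT => /ltW.
under eq_integral do rewrite EFinM.
rewrite ge0_integralZl//=.
- by rewrite integral_shift_powRN// -EFinM lee_fin mulrAC mulrA.
- by apply/measurable_EFinP; exact: measurable_shift_powR.
- by move=> t _; rewrite lee_fin powR_ge0.
- by rewrite lee_fin ltW.
Qed.

End kernel_upper_bound.

(** * Domination by sums over dyadic cubes *)

Section dyadic.
Context {R : realType}.

Lemma dyadic_bracket (y : R) : 1 <= y ->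
  exists k : nat, 2 ^+ k <= y < 2 ^+ k.+1.
Proof.
move=> y1; have ex : exists k : nat, y < 2 ^+ k.
  exists (Num.truncn y).+1; rewrite (lt_le_trans (truncnS_gt _))//.
  by rewrite -natrX ler_nat ltnW// ltn_expl.
case: (ex_minnP ex) => -[|k] h1 h2.
  by move: h1; rewrite expr0 ltNge y1.
exists k; rewrite h1 andbT leNgt; apply/negP => /h2.
by rewrite ltnn.
Qed.

Lemma geometric_powR_sum_le (A q r e : R) : 0 <= A -> 0 < q -> 0 < r -> q `^ e < 1 ->
  (\sum_(k <oo) (A * (r * q ^+ k) `^ e)%:E <= (A * r `^ e / (1 - q `^ e))%:E)%E.
Proof.
move=> A0 q0 r0 qe.
have Ar : 0 <= A * r `^ e by rewrite mulr_ge0// powR_ge0.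
have E k : A * (r * q ^+ k) `^ e = geometric (A * r `^ e) (q `^ e) k.
  rewrite /geometric /= powRM ?exprn_ge0 ?(ltW r0) ?(ltW q0)// mulrA.
  by rewrite -[q ^+ k]powR_mulrn ?(ltW q0)// powRAC powR_mulrn ?powR_ge0.
apply: lime_le.
  by apply: is_cvg_nneseries => n _ _; rewrite lee_fin mulr_ge0// powR_ge0.
apply: nearW => n; rewrite sumEFin lee_fin.
have := @geometric_le_lim R n (A * r `^ e) (q `^ e) Ar (powR_gt0 _ q0).
rewrite ger0_norm ?powR_ge0// => /(_ qe); apply: le_trans.
by rewrite seriesEnat/=; under eq_bigr do rewrite E.
Qed.

Context {d : nat}.
Local Notation sp := (space R d).
Local Notation mu := (@lebesgue_space R d).
Implicit Types (z : sp) (g : sp -> R).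

(** sum_k r_k^(-a) 1_(cube z r_k) with r_k = r q^k: for q = 1/2 and q = 2 it
    is comparable to |z - z'|^(-a), restricted to |z - z'| <= r and to
    |z - z'| > r respectively, but its integrals are geometric series. *)
Definition cube_sum (a q r : R) (z z' : sp) : \bar R :=
  (\sum_(k <oo) ((r * q ^+ k) `^ (- a) * \1_(cube z (r * q ^+ k)) z')%:E)%E.

Lemma cube_sum_ge0 a q r z z' : (0 <= cube_sum a q r z z')%E.
Proof. by apply: nneseries_ge0 => k _ _; rewrite lee_fin mulr_ge0// powR_ge0. Qed.

Lemma cube_sum_ge_term a q r z z' k : cube z (r * q ^+ k) z' ->
  (((r * q ^+ k) `^ (- a))%:E <= cube_sum a q r z z')%E.
Proof.
move=> zk; rewrite /cube_sum.
apply: le_trans (nneseries_lim_ge k.+1 _); last first.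
  by move=> n _ _; rewrite lee_fin mulr_ge0// powR_ge0.
rewrite big_nat_recr//= indicE mem_set// mulr1 leeDr//.
by apply: sume_ge0 => i _; rewrite lee_fin mulr_ge0// powR_ge0.
Qed.

(** On the diagonal the kernel may be infinite, and so is this sum: all cubes
    contain the point and their weights do not tend to 0. *)
Lemma cube_sum_diag a r z z' : 0 < a -> 0 < r -> sqnorm_sub z z' = 0 ->
  cube_sum a (2^-1) r z z' = +oo%E.
Proof.
move=> a0 r0 D0; apply/eqyP => M M0.
have kk k : cube z (r * 2^-1 ^+ k) z'.
  by apply: sqnorm_sub_cube; rewrite ?D0 ?sqr_ge0// mulr_ge0 ?exprn_ge0 ?invr_ge0 ?(ltW r0).
pose x := M `^ (a^-1) * r.
have x0 : 0 < x by rewrite mulr_gt0// powR_gt0.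
have [k hk] : exists k : nat, x <= 2 ^+ k.
  exists (Num.truncn x).+1; rewrite (le_trans (ltW (truncnS_gt _)))//.
  by rewrite -natrX ler_nat ltnW// ltn_expl.
apply: le_trans (cube_sum_ge_term a (kk k)); rewrite lee_fin.
have h2 : 0 < 2 ^+ k :> R by rewrite exprn_gt0.
rewrite powRN -powR_inv1 ?powR_ge0// powRAC powR_inv1; last first.
  by rewrite mulr_ge0 ?exprn_ge0 ?invr_ge0 ?(ltW r0).
rewrite exprVn invfM invrK.
have -> : M = (M `^ a^-1) `^ a by rewrite -powRrM mulVf ?gt_eqF// powRr1 ?ltW.
apply: ler_powR2r; [exact: ltW|exact: powR_ge0|].
by rewrite mulrC ler_pdivlMr.
Qed.

Lemma powR_sqrt_exponent (D a : R) : 0 <= D -> D `^ (- (a / 2)) = (Num.sqrt D) `^ (- a).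
Proof.
by move=> D0; rewrite -powR12_sqrt// -powRrM; congr (_ `^ _); field.
Qed.

Lemma riesz_le_cube_sum_near a r z z' : 0 < a -> 0 < r -> 0 < sqnorm_sub z z' ->
  sqnorm_sub z z' <= r ^+ 2 ->
  ((sqnorm_sub z z' `^ (- (a / 2)))%:E <= (2 `^ a)%:E * cube_sum a (2^-1) r z z')%E.
Proof.
move=> a0 r0; set D := sqnorm_sub z z' => D0 Dr; rewrite powR_sqrt_exponent ?(ltW D0)//.
set m := Num.sqrt D; have m0 : 0 < m by rewrite sqrtr_gt0.
have mr : m <= r by rewrite -[r]ger0_norm ?(ltW r0)// -sqrtr_sqr ler_wsqrtr.
have [k /andP[k1 k2]] := @dyadic_bracket (r / m) (ltac:(by rewrite ler_pdivlMr// mul1r)).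
have h2 : 0 < 2 ^+ k :> R by rewrite exprn_gt0.
have zk : cube z (r * 2^-1 ^+ k) z'.
  apply: sqnorm_sub_cube; first by rewrite mulr_ge0 ?exprn_ge0 ?invr_ge0 ?(ltW r0).
  rewrite -/D -(sqr_sqrtr (ltW D0)) -/m ler_sqr ?nnegrE ?(ltW m0)//; last first.
    by rewrite mulr_ge0 ?exprn_ge0 ?invr_ge0 ?(ltW r0).
  by rewrite exprVn ler_pdivlMr// mulrC -ler_pdivlMr.
apply: (@le_trans _ _ ((2 `^ a)%:E * ((r * 2^-1 ^+ k) `^ (- a))%:E)%E); last first.
  by rewrite lee_pmul2l ?lte_fin ?powR_gt0//; exact: cube_sum_ge_term.
rewrite -EFinM lee_fin.
have -> : 2 `^ a = 2^-1 `^ (- a) :> R by rewrite -powR_inv1// -powRrM mulN1r opprK.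
rewrite -powRM ?mulr_ge0 ?invr_ge0 ?exprn_ge0 ?(ltW r0) ?invr_ge0//.
apply: ler_powRN2r; [exact: ltW|by rewrite !mulr_gt0 ?exprn_gt0 ?invr_gt0|].
rewrite exprVn mulrCA -invfM -exprS ler_pdivrMr ?exprn_gt0// mulrC.
by rewrite -ler_pdivrMr// ltW.
Qed.

Lemma riesz_le_cube_sum_far a r z z' : 0 < a -> 0 < r ->
  r ^+ 2 < sqnorm_sub z z' ->
  ((sqnorm_sub z z' `^ (- (a / 2)))%:E <= (2 `^ a)%:E * cube_sum a 2 r z z')%E.
Proof.
move=> a0 r0; set D := sqnorm_sub z z' => Dr.
have D0 : 0 < D by apply: le_lt_trans Dr; exact: sqr_ge0.
rewrite powR_sqrt_exponent ?(ltW D0)//.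
set m := Num.sqrt D; have m0 : 0 < m by rewrite sqrtr_gt0.
have mr : r <= m by rewrite -[r]ger0_norm ?(ltW r0)// -sqrtr_sqr ler_wsqrtr// ltW.
have [k /andP[k1 k2]] := @dyadic_bracket (m / r) (ltac:(by rewrite ler_pdivlMr// mul1r)).
have h2 : 0 < 2 ^+ k :> R by rewrite exprn_gt0.
have zk : cube z (r * 2 ^+ k.+1) z'.
  apply: sqnorm_sub_cube; first by rewrite mulr_ge0 ?exprn_ge0 ?(ltW r0).
  rewrite -/D -(sqr_sqrtr (ltW D0)) -/m ler_sqr ?nnegrE ?(ltW m0)//; last first.
    by rewrite mulr_ge0 ?exprn_ge0 ?(ltW r0).
  by rewrite mulrC -ler_pdivrMr// ltW.
apply: (@le_trans _ _ ((2 `^ a)%:E * ((r * 2 ^+ k.+1) `^ (- a))%:E)%E); last first.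
  by rewrite lee_pmul2l ?lte_fin ?powR_gt0//; exact: cube_sum_ge_term.
rewrite -EFinM lee_fin exprS mulrCA powRM ?mulr_ge0 ?exprn_ge0 ?(ltW r0)//.
rewrite mulrA -powRD ?subrr ?powRr0 ?mul1r; last by rewrite eqxx; apply/implyP => _; rewrite pnatr_eq0.
apply: ler_powRN2r; [exact: ltW|by rewrite mulr_gt0|].
by rewrite mulrC -ler_pdivlMr.
Qed.

(** The exponent may be chosen differently near the diagonal and far from it,
    so that both geometric series converge in each application. *)
Lemma Hpar_kernel_le_cube_sums (s b1 b2 : R) : (1 <= d)%N -> 0 < s ->
  b1 <= 2 * s -> b2 <= 2 * s -> b1 < d.+1%:R -> b2 < d.+1%:R ->
  exists2 C : R, 0 < C & forall r z z', 0 < r ->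
    (Hpar_kernel s z z' <= C%:E * (cube_sum (d.+1%:R - b1) (2^-1) r z z' +
                                  cube_sum (d.+1%:R - b2) 2 r z z'))%E.
Proof.
move=> d1 s0 b1s b2s b1n b2n.
have [C1 C10 h1] := @Hpar_kernel_le R d s b1 d1 s0 b1s b1n.
have [C2 C20 h2] := @Hpar_kernel_le R d s b2 d1 s0 b2s b2n.
set a1 := d.+1%:R - b1 in h1 *; set a2 := d.+1%:R - b2 in h2 *.
have a10 : 0 < a1 by rewrite subr_gt0.
have a20 : 0 < a2 by rewrite subr_gt0.
pose c1 := C1 * 2 `^ a1; pose c2 := C2 * 2 `^ a2.
have c10 : 0 < c1 by rewrite mulr_gt0// powR_gt0.
have c20 : 0 < c2 by rewrite mulr_gt0// powR_gt0.
exists (c1 + c2); first exact: addr_gt0.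
move=> r z z' r0; set S1 := cube_sum a1 _ r z z'; set S2 := cube_sum a2 _ r z z'.
have S10 : (0 <= S1)%E by exact: cube_sum_ge0.
have S20 : (0 <= S2)%E by exact: cube_sum_ge0.
have g1 : (c1%:E * S1 <= (c1 + c2)%:E * (S1 + S2))%E.
  apply: lee_pmul => //; rewrite ?lee_fin ?(ltW c10)//; first by rewrite lerDl ltW.
  by rewrite leeDl.
have g2 : (c2%:E * S2 <= (c1 + c2)%:E * (S1 + S2))%E.
  apply: lee_pmul => //; rewrite ?lee_fin ?(ltW c20)//; first by rewrite lerDr ltW.
  by rewrite leeDr.
have [D0|D0] := eqVneq (sqnorm_sub z z') 0.
  have -> : S1 = +oo%E by exact: cube_sum_diag.
  by rewrite addye ?gt0_muley ?leey ?lte_fin ?addr_gt0// gt_eqF// (lt_le_trans _ S20).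
have {}D0 : 0 < sqnorm_sub z z' by rewrite lt_def D0 sqnorm_sub_ge0.
have [Dr|Dr] := leP (sqnorm_sub z z') (r ^+ 2).
  apply: le_trans g1; apply: le_trans (h1 _ _ D0) _.
  rewrite /c1 2!EFinM -muleA lee_pmul2l ?lte_fin//.
  exact: riesz_le_cube_sum_near.
apply: le_trans g2; apply: le_trans (h2 _ _ D0) _.
rewrite /c2 2!EFinM -muleA lee_pmul2l ?lte_fin//.
exact: riesz_le_cube_sum_far.
Qed.

Lemma measurable_cube_sum a q r z : measurable_fun [set: sp] (cube_sum a q r z).
Proof.
apply: ge0_emeasurable_sum => [k x _ _|k _].
  by rewrite lee_fin mulr_ge0// powR_ge0.
apply/measurable_EFinP; apply: measurable_funM; first exact: measurable_cst.
by apply: measurable_indic; exact: measurable_cube.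
Qed.

Lemma integral_cube_sum_le a q r z g (A e : R) :
  0 < q -> 0 < r -> 0 <= A -> (forall x, 0 <= g x) -> measurable_fun [set: sp] g ->
  q `^ (e - a) < 1 ->
  (forall rho, 0 < rho ->
    (\int[mu]_(x in cube z rho) (g x)%:E <= (A * rho `^ e)%:E)%E) ->
  (\int[mu]_x (cube_sum a q r z x * (g x)%:E) <=
     (A * r `^ (e - a) / (1 - q `^ (e - a)))%:E)%E.
Proof.
move=> q0 r0 A0 g0 mg qe h.
have rq k : 0 < r * q ^+ k by rewrite mulr_gt0// exprn_gt0.
pose u k x := ((r * q ^+ k) `^ (- a) * \1_(cube z (r * q ^+ k)) x * g x)%:E.
have E x : (cube_sum a q r z x * (g x)%:E)%E = (\sum_(k <oo) u k x)%E.
  rewrite muleC -nneseriesZl; last first.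
    by move=> k _; rewrite lee_fin mulr_ge0// powR_ge0.
  by apply: eq_eseriesr => k _; rewrite -EFinM mulrC.
under eq_integral do rewrite E.
rewrite integral_nneseries//; first last.
- by move=> k x _; rewrite lee_fin !mulr_ge0// powR_ge0.
- move=> k; apply/measurable_EFinP; apply: measurable_funM => //.
  apply: measurable_funM; first exact: measurable_cst.
  by apply: measurable_indic; exact: measurable_cube.
apply: le_trans (@geometric_powR_sum_le A q r (e - a) A0 q0 r0 qe).
apply: lee_nneseries => k.
  by move=> _ _; apply: integral_ge0 => x _; rewrite lee_fin !mulr_ge0// powR_ge0.
move=> _.
have -> : (\int[mu]_x u k x =
    ((r * q ^+ k) `^ (- a))%:E * \int[mu]_(x in cube z (r * q ^+ k)) (g x)%:E)%E.
  rewrite -ge0_integralZl//=; last 4 first.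
  - exact: measurable_cube.
  - by apply/measurable_EFinP; exact: measurable_funTS.
  - by move=> x _; rewrite lee_fin.
  - by rewrite lee_fin powR_ge0.
  rewrite [RHS]integral_mkcond; apply: eq_integral => x _.
  rewrite /u patchE indicE; case: ifPn => _; first by rewrite mulr1 EFinM.
  by rewrite mulr0 mul0r.
apply: le_trans (_ : ((r * q ^+ k) `^ (- a))%:E * (A * (r * q ^+ k) `^ e)%:E <= _)%E.
  by rewrite lee_pmul2l ?lte_fin ?powR_gt0//; exact: h.
rewrite -EFinM lee_fin mulrCA -powRD ?(gt_eqF (rq k)) ?implybT//.
by rewrite addrC lexx.
Qed.

End dyadic.

(** * Pointwise bounds for the integral operator *)

Section pointwise_bounds.
Context {R : realType} {d : nat}.
Local Notation sp := (space R d).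
Local Notation mu := (@lebesgue_space R d).
Local Notation n := (d.+1%:R : R).
Implicit Types (z : sp) (g : sp -> R).

Definition Hpar_int (s : R) (g : sp -> R) (z : sp) : \bar R :=
  (\int[mu]_x (Hpar_kernel s z x * (g x)%:E))%E.

Lemma Hpar_int_ge0 s g z : 0 < s -> (forall x, 0 <= g x) -> (0 <= Hpar_int s g z)%E.
Proof.
move=> s0 g0; apply: integral_ge0 => x _.
by rewrite mule_ge0 ?lee_fin// Hpar_kernel_ge0.
Qed.

Lemma measurable_kernel_mul s g z : measurable_fun [set: sp] g ->
  measurable_fun [set: sp] (fun x => (Hpar_kernel s z x * (g x)%:E)%E).
Proof.
move=> mg; apply: emeasurable_funM; first exact: measurable_Hpar_kernel.
exact/measurable_EFinP.
Qed.

(** All pointwise bounds come from this one: a growth rate rho^e for the mass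
    of g on cubes of size rho turns the dyadic sums into geometric series. *)
Lemma Hpar_int_le (s b1 b2 e1 e2 : R) : (1 <= d)%N -> 0 < s ->
  b1 <= 2 * s -> b2 <= 2 * s -> b1 < n -> b2 < n ->
  n - b1 < e1 -> e2 < n - b2 ->
  exists2 C : R, 0 < C & forall (A1 A2 r : R) g z, 0 <= A1 -> 0 <= A2 -> 0 < r ->
    (forall x, 0 <= g x) -> measurable_fun [set: sp] g ->
    (forall rho, 0 < rho -> (\int[mu]_(x in cube z rho) (g x)%:E <= (A1 * rho `^ e1)%:E)%E) ->
    (forall rho, 0 < rho -> (\int[mu]_(x in cube z rho) (g x)%:E <= (A2 * rho `^ e2)%:E)%E) ->
    (Hpar_int s g z <=
      (C * (A1 * r `^ (e1 - (n - b1)) + A2 * r `^ (e2 - (n - b2))))%:E)%E.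
Proof.
move=> d1 s0 b1s b2s b1n b2n be1 be2.
have [C C0 hC] := @Hpar_kernel_le_cube_sums R d s b1 b2 d1 s0 b1s b2s b1n b2n.
set a1 := n - b1 in hC be1 *; set a2 := n - b2 in hC be2 *.
have lt1 x : 0 < x -> 2^-1 `^ x < 1 :> R.
  move=> x0; have {2}<- : 1 `^ x = 1 :> R by rewrite powR1.
  apply: gt0_ltr_powR => //; rewrite ?nnegrE//.
  by rewrite invf_lt1// ltr1n.
have q1 : 2^-1 `^ (e1 - a1) < 1 :> R by apply: lt1; rewrite subr_gt0.
have q2 : 2 `^ (e2 - a2) < 1 :> R.
  rewrite -[2]invrK -powR_inv1 ?invr_ge0// -powRrM mulN1r; apply: lt1.
  by rewrite oppr_gt0 subr_lt0.
pose c1 := (1 - 2^-1 `^ (e1 - a1))^-1; pose c2 := (1 - 2 `^ (e2 - a2))^-1.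
have c10 : 0 < c1 by rewrite invr_gt0 subr_gt0.
have c20 : 0 < c2 by rewrite invr_gt0 subr_gt0.
exists (C * (c1 + c2)); first by rewrite mulr_gt0// addr_gt0.
move=> A1 A2 r g z A10 A20 r0 g0 mg h1 h2.
apply: (@le_trans _ _ (\int[mu]_x (C%:E * (cube_sum a1 2^-1 r z x * (g x)%:E
      + cube_sum a2 2 r z x * (g x)%:E)))%E).
  apply: ge0_le_integral => //.
  - by move=> x _; rewrite mule_ge0 ?lee_fin// Hpar_kernel_ge0.
  - exact: measurable_kernel_mul.
  - apply: measurable_funeM; apply: emeasurable_funD; apply: emeasurable_funM;
      by [exact: measurable_cube_sum|exact/measurable_EFinP].
  - move=> x _; rewrite -ge0_muleDl ?cube_sum_ge0// muleA lee_wpmul2r ?lee_fin//.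
    exact: hC.
have mS a q : measurable_fun [set: sp] (fun x => (cube_sum a q r z x * (g x)%:E)%E).
  by apply: emeasurable_funM; [exact: measurable_cube_sum|exact/measurable_EFinP].
have S0 a q x : (0 <= cube_sum a q r z x * (g x)%:E)%E.
  by rewrite mule_ge0 ?cube_sum_ge0 ?lee_fin.
rewrite ge0_integralZl//=; last 3 first.
- exact: emeasurable_funD.
- by move=> x _; rewrite adde_ge0.
- by rewrite lee_fin ltW.
rewrite ge0_integralD// -mulrA [leRHS]EFinM lee_pmul2l ?lte_fin//.
have i1 := @integral_cube_sum_le R d a1 2^-1 r z g A1 e1 (ltac:(by rewrite invr_gt0)) r0 A10 g0 mg q1 h1.
have i2 := @integral_cube_sum_le R d a2 2 r z g A2 e2 (ltr0n _ 2) r0 A20 g0 mg q2 h2.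
apply: le_trans (leeD i1 i2) _.
rewrite -EFinD lee_fin -/c1 -/c2.
have h3 : 0 <= A1 * r `^ (e1 - a1) by rewrite mulr_ge0 ?powR_ge0.
have h4 : 0 <= A2 * r `^ (e2 - a2) by rewrite mulr_ge0 ?powR_ge0.
set X := A1 * _ in h3 *; set Y := A2 * _ in h4 *.
rewrite (_ : (c1 + c2) * (X + Y) = X * c1 + Y * c2 + (X * c2 + Y * c1)); last by ring.
by rewrite lerDl addr_ge0// mulr_ge0// ltW.
Qed.

Lemma cube_vol_powR (rho : R) : 0 < rho ->
  (2 * rho) ^+ d.+1 = 2 `^ n * rho `^ n.
Proof. by move=> rho0; rewrite -powR_mulrn ?mulr_ge0 ?ltW// powRM// ltW. Qed.

Lemma integral_cst_cube z (c rho : R) : 0 <= rho ->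
  (\int[mu]_(x in cube z rho) c%:E = (c * (2 * rho) ^+ d.+1)%:E)%E.
Proof.
move=> rho0; rewrite integral_cst; last exact: measurable_cube.
by rewrite EFinM; congr (_ * _)%E; exact: lebesgue_cube.
Qed.

Lemma integral_cube_bounded_le z g (B rho : R) : 0 < rho -> measurable_fun [set: sp] g ->
  (forall x, 0 <= g x <= B) ->
  (\int[mu]_(x in cube z rho) (g x)%:E <= (B * 2 `^ n * rho `^ n)%:E)%E.
Proof.
move=> rho0 mg gB.
apply: (@le_trans _ _ (\int[mu]_(x in cube z rho) B%:E)%E).
  apply: ge0_le_integral.
  - exact: measurable_cube.
  - by move=> x _; rewrite lee_fin; case/andP: (gB x).
  - by apply/measurable_EFinP; exact: measurable_funTS.
  - exact: measurable_cst.
  - by move=> x _; rewrite lee_fin; case/andP: (gB x).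
by rewrite integral_cst_cube ?(ltW rho0)// cube_vol_powR// mulrA.
Qed.

(** Splitting a function at height l, the elementary substitute for Young's
    inequality. *)
Lemma le_add_powR (P x l : R) : 1 < P -> 0 <= x -> 0 < l -> x <= l + l `^ (1 - P) * x `^ P.
Proof.
move=> P1 x0 l0; have [xl|lx] := leP x l.
  by rewrite (le_trans xl)// lerDl mulr_ge0 ?powR_ge0.
apply: (@le_trans _ _ (l `^ (1 - P) * x `^ P)); last by rewrite lerDr ltW.
have x0' := lt_trans l0 lx.
have {1}-> : x = x `^ (1 - P) * x `^ P.
  by rewrite -powRD ?subrK ?powRr1// ?(gt_eqF x0') ?implybT.
rewrite ler_wpM2r ?powR_ge0// (_ : 1 - P = - (P - 1)); last by ring.
by apply: ler_powRN2r => //; [lra|exact: ltW].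
Qed.

(** Hoelder's inequality against the indicator of a cube. *)
Lemma integral_cube_Lp_le z g (P rho : R) : 0 < rho -> 1 < P -> measurable_fun [set: sp] g ->
  (forall x, 0 <= g x) -> (\int[mu]_x (g x `^ P)%:E <= 1)%E ->
  (\int[mu]_(x in cube z rho) (g x)%:E <=
    (2 * 2 `^ (n - n / P) * rho `^ (n - n / P))%:E)%E.
Proof.
move=> rho0 P1 mg g0 gP.
have P0 : 0 < P by exact: lt_trans P1.
have r2 : 0 < 2 * rho by rewrite mulr_gt0.
(* this height l makes both terms of l + l^(1 - P) g^P contribute equally *)
pose l := (2 * rho) `^ (- (n / P)); have l0 : 0 < l by rewrite powR_gt0.
have mgP : measurable_fun [set: sp] (fun x => g x `^ P).
  exact: (measurableT_comp (measurable_powR _) mg).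
apply: (@le_trans _ _ (\int[mu]_(x in cube z rho) (l%:E + (l `^ (1 - P))%:E * (g x `^ P)%:E))%E).
  apply: ge0_le_integral.
  - exact: measurable_cube.
  - by move=> x _; rewrite lee_fin.
  - by apply/measurable_EFinP; exact: measurable_funTS.
  - apply: emeasurable_funD; first exact: measurable_cst.
    by apply: measurable_funeM; apply/measurable_EFinP; exact: measurable_funTS.
  - by move=> x _; rewrite -EFinM -EFinD lee_fin le_add_powR.
rewrite ge0_integralD; last 5 first.
- exact: measurable_cube.
- by move=> x _; rewrite lee_fin ltW.
- exact: measurable_cst.
- by move=> x _; rewrite -EFinM lee_fin mulr_ge0 ?powR_ge0.
- by apply: measurable_funeM; apply/measurable_EFinP; exact: measurable_funTS.
rewrite integral_cst_cube ?(ltW rho0)// ge0_integralZl; last 4 first.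
- exact: measurable_cube.
- by apply/measurable_EFinP; exact: measurable_funTS.
- by move=> x _; rewrite lee_fin powR_ge0.
- by rewrite lee_fin powR_ge0.
have h : (\int[mu]_(x in cube z rho) (g x `^ P)%:E <= 1)%E.
  apply: le_trans gP; apply: ge0_subset_integral => //.
  - exact: measurable_cube.
  - exact/measurable_EFinP.
  - by move=> x _; rewrite lee_fin powR_ge0.
apply: (@le_trans _ _ ((l * (2 * rho) ^+ d.+1)%:E + (l `^ (1 - P))%:E * 1)%E).
  by rewrite leeD2l// lee_wpmul2l ?lee_fin ?powR_ge0.
rewrite mule1 -EFinD lee_fin -mulrA -powRM ?(ltW rho0)//.
rewrite -powR_mulrn ?(ltW r2)// /l -powRrM -powRD ?(gt_eqF r2) ?implybT//.
rewrite (_ : - (n / P) + n = n - n / P); last by ring.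
rewrite (_ : - (n / P) * (1 - P) = n - n / P); last by field; rewrite gt_eqF.
by set X := (2 * rho) `^ _; lra.
Qed.

Lemma Hpar_int1_bounded (s : R) : (1 <= d)%N -> 0 < s -> 2 * s < n ->
  exists2 C : R, 0 < C & forall z, (Hpar_int s (fun=> 1%R) z <= C%:E)%E.
Proof.
move=> d1 s0 sn; have s2 : 0 < 2 * s by rewrite mulr_gt0.
have [C C0 hC] := @Hpar_int_le s (2 * s) (-1) n n d1 s0 (lexx _) (ltac:(lra)) sn
  (ltac:(by rewrite (lt_trans _ (ltr0Sn R d))// ltrN10)) (ltac:(lra)) (ltac:(lra)).
pose A : R := 1 * 2 `^ n; have A0 : 0 < A by rewrite mulr_gt0 ?powR_gt0.
exists (C * (A * 1 `^ (n - (n - 2 * s)) + A * 1 `^ (n - (n - -1)))).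
  by rewrite mulr_gt0// addr_gt0// mulr_gt0 ?powR_gt0.
move=> z; apply: hC; rewrite ?(ltW A0)//.
- by move=> rho rho0; apply: integral_cube_bounded_le => //= x; rewrite ler01 lexx.
- by move=> rho rho0; apply: integral_cube_bounded_le => //= x; rewrite ler01 lexx.
Qed.

Lemma Hpar_int_Lp_bounded (s p : R) : (1 <= d)%N -> 0 < s -> 2 * s < n ->
  n / (2 * s) < p ->
  exists2 C : R, 0 < C & forall g z, measurable_fun [set: sp] g -> (forall x, 0 <= g x) ->
    (\int[mu]_x (g x `^ p)%:E <= 1)%E -> (Hpar_int s g z <= C%:E)%E.
Proof.
move=> d1 s0 sn np; have s2 : 0 < 2 * s by rewrite mulr_gt0.
have n0 : 0 < n by rewrite ltr0n.
have p1 : 1 < p by apply: lt_trans np; rewrite ltr_pdivlMr// mul1r.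
have p0 : 0 < p by exact: lt_trans p1.
have nps : n / p < 2 * s by move: np; rewrite ltr_pdivrMr// ltr_pdivrMr// mulrC.
have np0 : 0 < n / p by rewrite divr_gt0.
have [C C0 hC] := @Hpar_int_le s (2 * s) 0 (n - n / p) (n - n / p) d1 s0 (lexx _)
  (ltW s2) sn n0 (ltac:(lra)) (ltac:(lra)).
pose A : R := 2 * 2 `^ (n - n / p); have A0 : 0 < A by rewrite mulr_gt0 ?powR_gt0.
eexists; last first.
  move=> g z mg g0 gp; apply: (hC A A 1 g z) => //; try exact: ltW.
  - by move=> rho rho0; apply: integral_cube_Lp_le.
  - by move=> rho rho0; apply: integral_cube_Lp_le.
by rewrite mulr_gt0// addr_gt0// mulr_gt0 ?powR_gt0.
Qed.

(** The estimate at the heart of the Hardy-Littlewood-Sobolev inequality; the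
    radius r = B^(-P/n) balances the bounds g <= B and norm_P g <= 1. *)
Lemma Hpar_int_bounded_Lp_le (s b P : R) : (1 <= d)%N -> 0 < s -> 0 < b -> b <= 2 * s ->
  2 * s < n -> 1 < P -> P * b < n ->
  exists2 C : R, 0 < C & forall (B : R) g z, 0 < B -> measurable_fun [set: sp] g ->
    (forall x, 0 <= g x <= B) -> (\int[mu]_x (g x `^ P)%:E <= 1)%E ->
    (Hpar_int s g z <= (C * B `^ (1 - P * b / n))%:E)%E.
Proof.
move=> d1 s0 b0 bs sn P1 Pbn.
have n0 : 0 < n by rewrite ltr0n.
have P0 : 0 < P by exact: lt_trans P1.
have bn : b < n by exact: le_lt_trans sn.
have bnP : b < n / P by rewrite ltr_pdivlMr// mulrC.
have [C C0 hC] := @Hpar_int_le s b b n (n - n / P) d1 s0 bs bs bn bn (ltac:(lra)) (ltac:(lra)).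
pose c : R := 2 * 2 `^ (n - n / P); have c0 : 0 < c by rewrite mulr_gt0 ?powR_gt0.
have n2 : 0 < 2 `^ n :> R by rewrite powR_gt0.
exists (C * (2 `^ n + c)); first by rewrite mulr_gt0// addr_gt0.
move=> B g z B0 mg gB gP; set r := B `^ (- (P / n)); have r0 : 0 < r by rewrite powR_gt0.
have g0 x : 0 <= g x by case/andP: (gB x).
have := hC (B * 2 `^ n) c r g z (ltW (mulr_gt0 B0 n2)) (ltW c0) r0 g0 mg
  (fun rho rho0 => integral_cube_bounded_le z rho0 mg gB)
  (fun rho rho0 => integral_cube_Lp_le z rho0 P1 mg g0 gP).
have -> : r `^ (n - (n - b)) = B `^ (- (P * b / n)).
  by rewrite -powRrM; congr (_ `^ _); field; rewrite gt_eqF.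
have -> : r `^ (n - n / P - (n - b)) = B `^ (1 - P * b / n).
  by rewrite -powRrM; congr (_ `^ _); field; rewrite !gt_eqF.
have -> : B * 2 `^ n * B `^ (- (P * b / n)) = 2 `^ n * B `^ (1 - P * b / n).
  by rewrite powRD ?(gt_eqF B0) ?implybT// powRr1 ?(ltW B0)//; ring.
by rewrite -mulrDl mulrA.
Qed.

End pointwise_bounds.

(** * Monotonicity and duality *)

Section monotonicity.
Import HBNNSimple.

(** The integral of a nonnegative function is a supremum over the simple
    functions below it, and there are more of those below v than below u. *)
Lemma ge0_integral_mono d (T : measurableType d) (R : realType)
    (mu : {measure set T -> \bar R}) (u v : T -> \bar R) :
  (forall x, 0 <= u x)%E -> (forall x, u x <= v x)%E ->
  (\int[mu]_x u x <= \int[mu]_x v x)%E.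
Proof.
move=> u0 uv; rewrite !ge0_integralTE//; last by move=> x; exact: le_trans (uv x).
apply: ereal_sup_le => _ [h /= hu <-]; exists h => //.
by move=> x; exact: le_trans (uv x).
Qed.

End monotonicity.

Section duality.
Context {R : realType} d (T : measurableType d) (mu : {sigma_finite_measure set T -> \bar R}).

(** Converse Hoelder inequality: test against a multiple of F_k^(q - 1), where
    F_k truncates F in height and in space to make its norm finite. *)
Lemma dual_Lq_bound (q P C : R) (F : T -> \bar R) : 1 < q -> P^-1 + q^-1 = 1 -> 0 <= C ->
  measurable_fun [set: T] F -> (forall z, 0 <= F z)%E ->
  (forall g : T -> R, measurable_fun [set: T] g -> (forall x, 0 <= g x) ->
    (\int[mu]_x (g x `^ P)%:E <= 1)%E -> (\int[mu]_x (F x * (g x)%:E) <= C%:E)%E) ->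
  (\int[mu]_x (F x `^ q) <= (C `^ q)%:E)%E.
Proof.
move=> q1 Pq C0 mF F0 hF.
have q0 : 0 < q by exact: lt_trans q1.
have Pi : P^-1 = 1 - q^-1 by rewrite -Pq addrK.
have Pi0 : 0 < P^-1 by rewrite Pi subr_gt0 invf_lt1.
have P0 : 0 < P by rewrite -invr_gt0.
have /sigma_finiteP[A [UA ndA Afin]] := sigma_finiteT mu.
pose m k z : \bar R := Order.min (F z) k%:R%:E.
pose Fk k z : R := fine (m k z) * \1_(A k) z.
have m_fin k z : m k z \is a fin_num.
  rewrite fin_numElt; apply/andP; split.
    by rewrite lt_min (lt_le_trans _ (F0 z))//= ltNyr.
  by rewrite gt_min ltry orbT.
have m0 k z : (0 <= m k z)%E by rewrite le_min F0 lee_fin /=.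
have mle k z : (m k z <= F z)%E by rewrite ge_min lexx.
have mk k z : fine (m k z) <= k%:R.
  by rewrite -lee_fin fineK// ge_min lexx orbT.
have Fk0 k z : 0 <= Fk k z by rewrite mulr_ge0// fine_ge0.
have mFk k : measurable_fun [set: T] (Fk k).
  apply: measurable_funM.
    apply: (measurableT_comp (@fine_measurable R _ measurableT)).
    by apply: measurable_mine => //; exact: measurable_cst.
  by apply: measurable_indic; case: (Afin k).
have mFkq k : measurable_fun [set: T] (fun z => Fk k z `^ q).
  exact: (measurableT_comp (measurable_powR _) (mFk k)).
have FkF k z : ((Fk k z)%:E <= F z)%E.
  rewrite /Fk indicE; case: (_ \in _); last by rewrite mulr0.
  by rewrite mulr1 fineK.
have bound k : (\int[mu]_z (Fk k z `^ q)%:E <= (C `^ q)%:E)%E.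
  set M := (\int[mu]_z _)%E.
  have M0 : (0 <= M)%E by apply: integral_ge0 => z _; rewrite lee_fin powR_ge0.
  have Mfin : M \is a fin_num.
    rewrite ge0_fin_numE//.
    apply: (@le_lt_trans _ _ (\int[mu]_(z in A k) (k%:R `^ q)%:E)%E).
      rewrite [leRHS]integral_mkcond; apply: ge0_le_integral => //.
      - by move=> z _; rewrite lee_fin powR_ge0.
      - exact/measurable_EFinP.
      - apply/(measurable_restrictT _ _).1; first by case: (Afin k).
        exact: measurable_cst.
      - move=> z _; rewrite patchE /Fk indicE; case: ifPn => _.
          by rewrite mulr1 lee_fin ler_powR2r ?fine_ge0// ltW.
        by rewrite mulr0 powR0// gt_eqF.
    rewrite integral_cst; last by case: (Afin k).
    by apply: lte_mul_pinfty; rewrite ?lee_fin ?powR_ge0//; case: (Afin k).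
  rewrite -(fineK Mfin) lee_fin; set r := fine M.
  have r0 : 0 <= r by exact: fine_ge0.
  move: r0; rewrite le_eqVlt => /predU1P[<-|r0]; first exact: powR_ge0.
  pose g z := r `^ (- P^-1) * Fk k z `^ (q - 1).
  have qP : (q - 1) * P = q.
    have -> : P = (1 - q^-1)^-1 by rewrite -Pi invrK.
    by field; rewrite (gt_eqF q0) subr_eq0 (gt_eqF q1).
  have Fkq z : Fk k z * Fk k z `^ (q - 1) = Fk k z `^ q by exact: mulr_powRB1.
  have mg : measurable_fun [set: T] g.
    apply: measurable_funM; first exact: measurable_cst.
    exact: (measurableT_comp (measurable_powR _) (mFk k)).
  have g0 z : 0 <= g z by rewrite mulr_ge0 ?powR_ge0.
  have gP z : g z `^ P = r^-1 * Fk k z `^ q.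
    rewrite powRM ?powR_ge0// -!powRrM qP mulNr mulVf ?gt_eqF//.
    by rewrite powR_inv1// ltW.
  have hg : (\int[mu]_z (g z `^ P)%:E <= 1)%E.
    under eq_integral do rewrite gP EFinM.
    rewrite ge0_integralZl//=; last 3 first.
    - exact/measurable_EFinP.
    - by move=> z _; rewrite lee_fin powR_ge0.
    - by rewrite lee_fin invr_ge0 ltW.
    by rewrite -/M -(fineK Mfin) -/r -EFinM lee_fin mulVf ?gt_eqF.
  have := hF g mg g0 hg.
  have : (\int[mu]_z ((r `^ (- P^-1))%:E * (Fk k z `^ q)%:E) <=
      \int[mu]_z (F z * (g z)%:E))%E.
    apply: ge0_le_integral => //.
    - by move=> z _; rewrite -EFinM lee_fin mulr_ge0 ?powR_ge0.
    - by apply: measurable_funeM; exact/measurable_EFinP.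
    - by apply: emeasurable_funM => //; exact/measurable_EFinP.
    - move=> z _; rewrite -EFinM -Fkq mulrCA EFinM lee_wpmul2r//.
      by rewrite lee_fin mulr_ge0 ?powR_ge0.
  have -> : (\int[mu]_z ((r `^ (- P^-1))%:E * (Fk k z `^ q)%:E) = (r `^ (- P^-1))%:E * M)%E.
    rewrite ge0_integralZl//.
    - exact/measurable_EFinP.
    - by move=> z _; rewrite lee_fin powR_ge0.
    - by rewrite lee_fin powR_ge0.
  rewrite -(fineK Mfin) -/r -EFinM => /le_trans /[apply]; rewrite lee_fin.
  rewrite -{2}(powRr1 (ltW r0)) -powRD ?(gt_eqF r0) ?implybT//.
  rewrite Pi opprB subrK => h.
  have {1}-> : r = (r `^ q^-1) `^ q by rewrite -powRrM mulVf ?gt_eqF// powRr1 ?ltW.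
  by apply: ler_powR2r => //; [exact: ltW|exact: powR_ge0].
have ndFk z : nondecreasing_seq (fun k => Fk k z).
  move=> i j ij; rewrite /Fk; apply: ler_pM => //; rewrite ?fine_ge0//.
    apply: fine_le => //; rewrite /m le_min !ge_min lexx/= lee_fin ler_nat.
    by apply/orP; right.
  rewrite !indicE ler_nat; case: (boolP (z \in A i)) => // zi.
  by rewrite mem_set//; have /subsetPset := ndA _ _ ij; apply; exact: set_mem.
have limFk z : (Fk k z `^ q)%:E @[k --> \oo] --> (F z `^ q)%E.
  have [N _ hN] : \forall k \near \oo, A k z.
    have : (\bigcup_i A i) z by rewrite -UA.
    move=> [i _ Aiz]; exists i => // j /= ij.
    by have /subsetPset := ndA _ _ ij; exact.
  case Fz : (F z) (F0 z) => [r||] // r0.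
  - rewrite poweR_EFin; apply: cvg_near_cst.
    exists (maxn N (Num.truncn r).+1) => // k /=; rewrite geq_max => /andP[Nk rk].
    rewrite /Fk indicE mem_set ?mulr1; last exact: hN.
    have rk' : r <= k%:R by rewrite (le_trans (ltW (truncnS_gt r)))// ler_nat.
    by rewrite /m Fz -EFin_min/= min_l.
  - rewrite poweRyr ?gt_eqF//; apply/cvgeyPge => X.
    exists (maxn N (maxn 1 (Num.truncn X).+1)) => // k /=; rewrite !geq_max => /and3P[Nk k1 Xk].
    rewrite /Fk indicE mem_set ?mulr1; last exact: hN.
    rewrite /m Fz minye/= lee_fin (@le_trans _ _ k%:R)//.
      by rewrite (le_trans (ltW (truncnS_gt X)))// ler_nat.
    by apply: le1r_powR; [rewrite ler1n|exact: ltW].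
have := @cvg_monotone_convergence _ T R mu setT measurableT (fun k z => (Fk k z `^ q)%:E).
have -> : (fun z => limn (fun k => (Fk k z `^ q)%:E)) = (fun z => F z `^ q)%E.
  by apply/funext => z; exact: cvg_lim.
move=> H; have {}H := H (fun k => (measurable_EFinP _ _).2 (mFkq k))
  (fun k z _ => powR_ge0 _ _).
have {}H : (\int[mu]_z (Fk k z `^ q)%:E @[k --> \oo] --> \int[mu]_z (F z `^ q))%E.
  apply: H => z _ i j ij; rewrite lee_fin ler_powR2r ?(ltW q0)//; exact: ndFk.
rewrite -(cvg_lim _ H)//; apply: lime_le; first by apply/cvg_ex; eexists; exact: H.
exact: nearW.
Qed.

End duality.

(** * The Hardy-Littlewood-Sobolev inequality *)

Section hardy_littlewood_sobolev.
Context {R : realType} {d : nat}.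
Local Notation sp := (space R d).
Local Notation mu := (@lebesgue_space R d).
Local Notation n := (d.+1%:R : R).
Variable s : R.
Hypotheses (d1 : (1 <= d)%N) (s0 : 0 < s) (sn : 2 * s < n).
Local Notation K := (@Hpar_kernel R d s).
Local Notation T := (@Hpar_int R d s).

Definition cutoff (c : R) (g : sp -> R) (x : sp) : R := if g x <= c then g x else 0.

Lemma cutoff_ge0 c g x : (forall x, 0 <= g x) -> 0 <= cutoff c g x.
Proof. by move=> g0; rewrite /cutoff; case: ifP. Qed.

Lemma measurable_cutoff2 (f g : sp -> R) : measurable_fun [set: sp] f ->
  measurable_fun [set: sp] g ->
  measurable_fun [set: sp * sp] (fun w => cutoff (f w.1) g w.2).
Proof.
move=> mf mg; apply: measurable_fun_ifT.
- apply: measurable_fun_ler; first exact: (measurableT_comp mg measurable_snd).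
  exact: (measurableT_comp mf measurable_fst).
- exact: (measurableT_comp mg measurable_snd).
- exact: measurable_cst.
Qed.

Lemma measurable_cutoff c (g : sp -> R) : measurable_fun [set: sp] g ->
  measurable_fun [set: sp] (cutoff c g).
Proof.
move=> mg; apply: measurable_fun_ifT => //; apply: measurable_fun_ler => //.
Qed.

Lemma measurable_fubini_kernel (h : sp * sp -> R) : measurable_fun [set: sp * sp] h ->
  (forall w, 0 <= h w) ->
  measurable_fun [set: sp] (fun z => (\int[mu]_x (K z x * (h (z, x))%:E))%E).
Proof.
move=> mh h0.
apply: (@measurable_fun_fubini_tonelli_F _ _ sp sp R mu (fun w => K w.1 w.2 * (h w)%:E)%E).
  by apply: emeasurable_funM; [exact: measurable_Hpar_kernel2|exact/measurable_EFinP].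
by move=> w; rewrite mule_ge0 ?lee_fin// Hpar_kernel_ge0.
Qed.

Lemma measurable_Hpar_int (g : sp -> R) : measurable_fun [set: sp] g ->
  (forall x, 0 <= g x) -> measurable_fun [set: sp] (T g).
Proof.
move=> mg g0; apply: (@measurable_fubini_kernel (fun w => g w.2)) => //.
exact: (measurableT_comp mg measurable_snd).
Qed.

Lemma measurable_Hpar_int_cutoff (f g : sp -> R) : measurable_fun [set: sp] f ->
  measurable_fun [set: sp] g -> (forall x, 0 <= g x) ->
  measurable_fun [set: sp] (fun z => T (cutoff (f z) g) z).
Proof.
move=> mf mg g0.
apply: (@measurable_fubini_kernel (fun w => cutoff (f w.1) g w.2)).
  exact: measurable_cutoff2.
by move=> w; exact: cutoff_ge0.
Qed.

(** Half of the bilinear form: where g(x)^P <= f(z)^p, the inner integral is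
    at most C f(z)^(p - 1). *)
Lemma integral_cutoff_le (b p P : R) : 0 < b -> b <= 2 * s -> 1 < p -> 1 < P ->
  P * b < n -> p^-1 + P^-1 = 1 + b / n ->
  exists2 C : R, 0 < C & forall f g : sp -> R,
    measurable_fun [set: sp] f -> measurable_fun [set: sp] g ->
    (forall x, 0 <= f x) -> (forall x, 0 <= g x) ->
    (\int[mu]_x (f x `^ p)%:E <= 1)%E -> (\int[mu]_x (g x `^ P)%:E <= 1)%E ->
    (\int[mu]_z ((f z)%:E * T (cutoff (f z `^ (p / P)) g) z) <= C%:E)%E.
Proof.
move=> b0 bs p1 P1 Pbn E.
have n0 : 0 < n by rewrite ltr0n.
have p0 : 0 < p by exact: lt_trans p1.
have P0 : 0 < P by exact: lt_trans P1.
have [C C0 hC] := @Hpar_int_bounded_Lp_le R d s b P d1 s0 b0 bs sn P1 Pbn.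
have expo : p / P * (1 - P * b / n) = p - 1.
  rewrite -(mulrA P b) (_ : b / n = p^-1 + P^-1 - 1); last by rewrite E addrAC subrr add0r.
  by field; rewrite !gt_eqF.
exists C => // f g mf mg f0 g0 fp gP.
have mfp : measurable_fun [set: sp] (fun x => f x `^ p).
  exact: (measurableT_comp (measurable_powR _) mf).
have mgP : measurable_fun [set: sp] (fun x => g x `^ P).
  exact: (measurableT_comp (measurable_powR _) mg).
have mfpP : measurable_fun [set: sp] (fun x => f x `^ (p / P)).
  exact: (measurableT_comp (measurable_powR _) mf).
apply: (@le_trans _ _ (\int[mu]_z (C%:E * (f z `^ p)%:E))%E); last first.
  rewrite ge0_integralZl//=; last 3 first.
  - exact/measurable_EFinP.
  - by move=> x _; rewrite lee_fin powR_ge0.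
  - by rewrite lee_fin ltW.
  by rewrite -[leRHS]mule1 lee_pmul2l// lte_fin.
apply: ge0_le_integral => //.
- move=> z _; rewrite mule_ge0 ?lee_fin//; apply: Hpar_int_ge0 => // x.
  exact: cutoff_ge0.
- apply: emeasurable_funM; first exact/measurable_EFinP.
  exact: measurable_Hpar_int_cutoff.
- by apply: measurable_funeM; exact/measurable_EFinP.
- move=> z _; have := f0 z; rewrite le_eqVlt => /predU1P[<-|fz0].
    by rewrite mul0e mule_ge0// lee_fin ?powR_ge0// ltW.
  have B0 : 0 < f z `^ (p / P) by rewrite powR_gt0.
  have := hC _ (cutoff (f z `^ (p / P)) g) z B0.
  have -> : (C%:E * (f z `^ p)%:E = (f z)%:E * (C * f z `^ (p / P) `^ (1 - P * b / n))%:E)%E.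
    rewrite -powRrM expo -!EFinM; congr EFin; rewrite mulrCA; congr (_ * _).
    by rewrite mulr_powRB1.
  move=> h; rewrite lee_pmul2l ?lte_fin//; apply: h.
  - exact: measurable_cutoff.
  - by move=> x; rewrite cutoff_ge0//= /cutoff; case: ifP => // _; exact: ltW.
  - apply: le_trans gP; apply: ge0_le_integral => //.
    + by move=> x _; rewrite lee_fin powR_ge0.
    + apply/measurable_EFinP.
      by apply: (measurableT_comp (measurable_powR _)); exact: measurable_cutoff.
    + exact/measurable_EFinP.
    + move=> x _; rewrite lee_fin /cutoff; case: ifP => _; first exact: lexx.
      by rewrite powR0 ?powR_ge0// gt_eqF.
Qed.

Lemma kernel_tonelli (h : sp * sp -> R) : measurable_fun [set: sp * sp] h ->
  (forall w, 0 <= h w) ->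
  (\int[mu]_z \int[mu]_x (K z x * (h (z, x))%:E) =
   \int[mu]_x \int[mu]_z (K x z * (h (z, x))%:E))%E.
Proof.
move=> mh h0.
rewrite (@fubini_tonelli _ _ sp sp R mu mu (fun w => K w.1 w.2 * (h w)%:E)%E).
- by apply: eq_integral => x _; apply: eq_integral => z _ /=; rewrite Hpar_kernelC.
- by apply: emeasurable_funM; [exact: measurable_Hpar_kernel2|exact/measurable_EFinP].
- by move=> w; rewrite mule_ge0 ?lee_fin// Hpar_kernel_ge0.
Qed.

Lemma mul_Hpar_int c (g : sp -> R) z : 0 <= c -> measurable_fun [set: sp] g ->
  (forall x, 0 <= g x) ->
  (c%:E * T g z = \int[mu]_x (K z x * (c * g x)%:E))%E.
Proof.
move=> c0 mg g0; rewrite -ge0_integralZl//=.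
- by apply: eq_integral => x _; rewrite EFinM muleCA.
- exact: measurable_kernel_mul.
- by move=> x _; rewrite mule_ge0 ?lee_fin// Hpar_kernel_ge0.
Qed.

(** The Hardy-Littlewood-Sobolev inequality in bilinear form: at each pair
    (z, x) one of the two functions is small compared with the other, and the
    symmetry of the kernel exchanges the two cases. *)
Lemma Hpar_bilinear_le (b p P : R) : 0 < b -> b <= 2 * s -> 1 < p -> 1 < P ->
  P * b < n -> p * b < n -> p^-1 + P^-1 = 1 + b / n ->
  exists2 C : R, 0 < C & forall f g : sp -> R,
    measurable_fun [set: sp] f -> measurable_fun [set: sp] g ->
    (forall x, 0 <= f x) -> (forall x, 0 <= g x) ->
    (\int[mu]_x (f x `^ p)%:E <= 1)%E -> (\int[mu]_x (g x `^ P)%:E <= 1)%E ->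
    (\int[mu]_z ((f z)%:E * T g z) <= C%:E)%E.
Proof.
move=> b0 bs p1 P1 Pbn pbn E.
have [C1 C10 h1] := integral_cutoff_le b0 bs p1 P1 Pbn E.
have [C2 C20 h2] := integral_cutoff_le b0 bs P1 p1 pbn (etrans (addrC _ _) E).
have p0 : 0 < p by exact: lt_trans p1.
have P0 : 0 < P by exact: lt_trans P1.
exists (C1 + C2); first exact: addr_gt0.
move=> f g mf mg f0 g0 fp gP.
have mfst (u : sp -> R) : measurable_fun [set: sp] u ->
  measurable_fun [set: sp * sp] (fun w => u w.1).
  by move=> m; exact: (measurableT_comp m measurable_fst).
have msnd (u : sp -> R) : measurable_fun [set: sp] u ->
  measurable_fun [set: sp * sp] (fun w => u w.2).
  by move=> m; exact: (measurableT_comp m measurable_snd).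
have mpow (u : sp -> R) (a : R) : measurable_fun [set: sp] u ->
  measurable_fun [set: sp] (fun x => u x `^ a).
  by move=> m; exact: (measurableT_comp (measurable_powR _) m).
pose k1 (w : sp * sp) := f w.1 * cutoff (f w.1 `^ (p / P)) g w.2.
pose k2 (w : sp * sp) := g w.2 * cutoff (g w.2 `^ (P / p)) f w.1.
have k10 w : 0 <= k1 w by rewrite mulr_ge0// cutoff_ge0.
have k20 w : 0 <= k2 w by rewrite mulr_ge0// cutoff_ge0.
have mk1 : measurable_fun [set: sp * sp] k1.
  by apply: measurable_funM; [exact: mfst|exact: (measurable_cutoff2 (mpow _ (p / P) mf) mg)].
have mk2 : measurable_fun [set: sp * sp] k2.
  apply: measurable_funM; first exact: msnd.
  exact: (measurableT_comp (measurable_cutoff2 (mpow _ (P / p) mg) mf)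
    (@measurable_swap _ _ sp sp)).
(* if g(x) > f(z)^(p/P) then f(z) <= g(x)^(P/p) *)
have cover w : f w.1 * g w.2 <= k1 w + k2 w.
  rewrite /k1 /k2 /cutoff; case: ifPn => [_|]; first by rewrite lerDl k20.
  rewrite -ltNge => h; rewrite mulr0 add0r.
  case: ifPn => [_|/negP]; first by rewrite mulrC lexx.
  case; apply: (@le_trans _ _ ((f w.1 `^ (p / P)) `^ (P / p))).
    by rewrite -powRrM mulrA divfK ?gt_eqF// divff ?gt_eqF// powRr1 ?lexx.
  by apply: ler_powR2r; [rewrite divr_ge0 ?ltW|exact: powR_ge0|exact: ltW].
have mK2 (h : sp * sp -> R) : measurable_fun [set: sp * sp] h -> forall z,
    measurable_fun [set: sp] (fun x => (K z x * (h (z, x))%:E)%E).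
  move=> mh z; apply: emeasurable_funM; first exact: measurable_Hpar_kernel.
  by apply/measurable_EFinP; apply: (measurableT_comp mh); exact: measurable_pair1.
have K0 (h : sp * sp -> R) : (forall w, 0 <= h w) -> forall z x, (0 <= K z x * (h (z, x))%:E)%E.
  by move=> h0 z x; rewrite mule_ge0 ?lee_fin// Hpar_kernel_ge0.
apply: (@le_trans _ _ (\int[mu]_z (\int[mu]_x (K z x * (k1 (z, x))%:E)
     + \int[mu]_x (K z x * (k2 (z, x))%:E)))%E).
  apply: ge0_le_integral => //.
  - by move=> z _; rewrite mule_ge0 ?lee_fin//; exact: Hpar_int_ge0.
  - by apply: emeasurable_funM; [exact/measurable_EFinP|exact: measurable_Hpar_int].
  - by apply: emeasurable_funD; exact: measurable_fubini_kernel.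
  - move=> z _; rewrite mul_Hpar_int// -ge0_integralD//; first last.
    - exact: mK2.
    - by move=> x _; exact: K0.
    - exact: mK2.
    - by move=> x _; exact: K0.
    apply: ge0_le_integral => //.
    + by move=> x _; rewrite mule_ge0 ?lee_fin ?mulr_ge0// Hpar_kernel_ge0.
    + by apply: (mK2 (fun w => f w.1 * g w.2)); apply: measurable_funM; [exact: mfst|exact: msnd].
    + by apply: emeasurable_funD; exact: mK2.
    + move=> x _; rewrite -ge0_muleDr ?lee_fin// lee_wpmul2l ?Hpar_kernel_ge0//.
      by rewrite -EFinD lee_fin; exact: (cover (z, x)).
rewrite ge0_integralD//; first last.
- exact: measurable_fubini_kernel.
- by move=> z _; apply: integral_ge0 => x _; exact: K0.
- exact: measurable_fubini_kernel.
- by move=> z _; apply: integral_ge0 => x _; exact: K0.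
rewrite EFinD; apply: leeD.
  apply: le_trans (h1 f g mf mg f0 g0 fp gP); rewrite le_eqVlt; apply/orP; left; apply/eqP.
  apply: eq_integral => z _; rewrite mul_Hpar_int//; first exact: measurable_cutoff.
  by move=> x; exact: cutoff_ge0.
rewrite kernel_tonelli//.
apply: le_trans (h2 g f mg mf g0 f0 gP fp); rewrite le_eqVlt; apply/orP; left; apply/eqP.
apply: eq_integral => z _; rewrite mul_Hpar_int//; first exact: measurable_cutoff.
by move=> x; exact: cutoff_ge0.
Qed.

End hardy_littlewood_sobolev.

(** * Boundedness between Lebesgue spaces *)

Section boundedness.
Context {R : realType} {d : nat}.
Local Notation sp := (space R d).
Local Notation mu := (@lebesgue_space R d).
Local Notation n := (d.+1%:R : R).
Variable s : R.
Hypotheses (d1 : (1 <= d)%N) (s0 : 0 < s).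
Local Notation K := (@Hpar_kernel R d s).
Local Notation T := (@Hpar_int R d s).

Lemma lebesgue_space_gt0 : (0 < mu setT)%E.
Proof.
pose z0 : space R d := (0 : R, [tuple of nseq d (0 : R)]).
have h : (0 < mu (cube z0 1))%E.
  by rewrite lebesgue_cube// lte_fin exprn_gt0// mulr_gt0.
apply: lt_le_trans h _; apply: le_measure; rewrite ?inE//.
exact: measurable_cube.
Qed.

Definition modulus (f : sp -> R[i]) (x : sp) : R := Normc.normc (f x).

Lemma modulusE f x :
  modulus f x = Num.sqrt (complex.Re (f x) ^+ 2 + complex.Im (f x) ^+ 2).
Proof. by rewrite /modulus; case: (f x). Qed.

Lemma modulus_ge0 f x : 0 <= modulus f x.
Proof. by rewrite modulusE sqrtr_ge0. Qed.

Lemma Re_le_modulus f x : `|complex.Re (f x)| <= modulus f x.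
Proof. by rewrite modulusE -sqrtr_sqr ler_wsqrtr// lerDl sqr_ge0. Qed.

Lemma Im_le_modulus f x : `|complex.Im (f x)| <= modulus f x.
Proof. by rewrite modulusE -sqrtr_sqr ler_wsqrtr// lerDr sqr_ge0. Qed.

Lemma modulus_le f x : modulus f x <= `|complex.Re (f x)| + `|complex.Im (f x)|.
Proof.
rewrite modulusE; set a := complex.Re _; set b := complex.Im _.
rewrite -[leRHS]ger0_norm ?addr_ge0// -sqrtr_sqr ler_wsqrtr// sqrrD !real_normK ?num_real//.
by rewrite -addrA lerD2l lerDr mulrn_wge0// mulr_ge0.
Qed.

Lemma measurable_modulus (f : sp -> R[i]) :
  measurable_fun [set: sp] (fun z => complex.Re (f z)) ->
  measurable_fun [set: sp] (fun z => complex.Im (f z)) ->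
  measurable_fun [set: sp] (modulus f).
Proof.
move=> mR mI.
have -> : modulus f = (fun x => (complex.Re (f x) ^+ 2 + complex.Im (f x) ^+ 2) `^ 2^-1).
  by apply/funext => x; rewrite modulusE powR12_sqrt// addr_ge0 ?sqr_ge0.
apply: (measurableT_comp (measurable_powR _)).
by apply: measurable_funD; exact: measurable_funX.
Qed.

Lemma abs_fine_integral_le (u : sp -> R) (g : sp -> R) z : measurable_fun [set: sp] u ->
  measurable_fun [set: sp] g -> (forall x, `|u x| <= g x) ->
  ((`|fine (\int[mu]_x (K z x * (u x)%:E))|)%:E <= T g z)%E.
Proof.
move=> mu' mg ug; apply: (@le_trans _ _ `|\int[mu]_x (K z x * (u x)%:E)|%E).
  by case: (integral _ _ _) => [r||] //=; rewrite normr0 ?leey.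
apply: le_trans (le_abse_integral _ _ _) _ => //; first exact: measurable_kernel_mul.
apply: ge0_le_integral => //.
- by apply: measurableT_comp => //; exact: measurable_kernel_mul.
- exact: measurable_kernel_mul.
- move=> x _; rewrite abseM gee0_abs ?Hpar_kernel_ge0// lee_wpmul2l ?Hpar_kernel_ge0//.
  by rewrite lee_fin.
Qed.

(** Where the integral of K f diverges, Hpar_pow takes the value 0, which
    satisfies the bound as well. *)
Lemma modulus_Hpar_pow_le (f : sp -> R[i]) z :
  measurable_fun [set: sp] (fun z => complex.Re (f z)) ->
  measurable_fun [set: sp] (fun z => complex.Im (f z)) ->
  ((modulus (Hpar_pow s f) z)%:E <= 2%:E * T (modulus f) z)%E.
Proof.
move=> mR mI; have ma := measurable_modulus mR mI.
apply: (@le_trans _ _ (T (modulus f) z + T (modulus f) z)%E); last first.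
  have : (0 <= T (modulus f) z)%E by apply: Hpar_int_ge0 => // x; exact: modulus_ge0.
  by move=> h; rewrite (_ : 2 = 1 + 1) // EFinD ge0_muleDl// mul1e lexx.
apply: (@le_trans _ _ (`|complex.Re (Hpar_pow s f z)| + `|complex.Im (Hpar_pow s f z)|)%:E).
  by rewrite lee_fin modulus_le.
rewrite EFinD; apply: leeD; apply: abs_fine_integral_le => // x.
- exact: Re_le_modulus.
- exact: Im_le_modulus.
Qed.

Lemma Lp_normE p (f : sp -> R[i]) : p != 0 ->
  Lp_norm p%:E f = ((\int[mu]_x (modulus f x `^ p)%:E) `^ p^-1)%E.
Proof.
move=> p0; rewrite /Lp_norm unlock /=; congr (_ `^ _)%E.
by apply: eq_integral => x _; rewrite -/(modulus f x) ger0_norm ?modulus_ge0.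
Qed.

Lemma Lp_norm_le p (f : sp -> R[i]) (C : R) : 0 < p -> 0 <= C ->
  (\int[mu]_x (modulus f x `^ p)%:E <= (C `^ p)%:E)%E -> (Lp_norm p%:E f <= C%:E)%E.
Proof.
move=> p0 C0 h; rewrite Lp_normE ?gt_eqF//.
have -> : C%:E = ((C `^ p)%:E `^ p^-1)%E.
  by rewrite poweR_EFin -powRrM mulfV ?gt_eqF// powRr1.
apply: gt0_ler_poweR => //; first by rewrite invr_ge0 ltW.
- rewrite in_itv/= leey andbT; apply: integral_ge0 => x _; rewrite lee_fin; exact: powR_ge0.
- by rewrite in_itv/= leey andbT lee_fin powR_ge0.
Qed.

Lemma Lp_norm_infty_le (f : sp -> R[i]) (C : R) :
  (forall x, modulus f x <= C) -> (Lp_norm +oo f <= C%:E)%E.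
Proof.
move=> h; rewrite /Lp_norm unlock lebesgue_space_gt0.
apply/ess_supP; apply: nearW => x /=.
by rewrite -/(modulus f x) ger0_norm ?modulus_ge0// lee_fin.
Qed.

Lemma integral_modulus_powR p (f : sp -> R[i]) (N : R) : 0 < p ->
  (Lp_norm p%:E f = N%:E)%E ->
  (\int[mu]_x (modulus f x `^ p)%:E = (N `^ p)%:E)%E.
Proof.
move=> p0; rewrite Lp_normE ?gt_eqF// => h.
rewrite -poweR_EFin -h -poweRrM mulVf ?gt_eqF// poweRe1//.
by apply: integral_ge0 => x _; rewrite lee_fin powR_ge0.
Qed.

Lemma Lp_norm_fin p (f : sp -> R[i]) : (Lp_norm p f < +oo)%E ->
  exists2 N : R, 0 <= N & Lp_norm p f = N%:E.
Proof.
move=> h; have h0 : (0 <= Lp_norm p f)%E by rewrite /Lp_norm; exact: Lnorm_ge0.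
exists (fine (Lp_norm p f)); first exact: fine_ge0.
by rewrite fineK// ge0_fin_numE.
Qed.

(** By homogeneity it is enough to bound the integral operator on the unit
    ball; scaling by N + eps instead of N also covers N = 0. *)
Lemma scaled_unit_ball p (f : sp -> R[i]) (N e : R) : 0 < p -> 0 <= N -> 0 < e ->
  measurable_fun [set: sp] (fun z => complex.Re (f z)) ->
  measurable_fun [set: sp] (fun z => complex.Im (f z)) ->
  (Lp_norm p%:E f = N%:E)%E ->
  exists g : sp -> R, [/\ measurable_fun [set: sp] g, forall x, 0 <= g x,
    (\int[mu]_x (g x `^ p)%:E <= 1)%E &
    forall z, ((modulus (Hpar_pow s f) z)%:E <= (2 * (N + e))%:E * T g z)%E].
Proof.
move=> p0 N0 e0 mR mI fN; have ma := measurable_modulus mR mI.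
have l0 : 0 < N + e by rewrite ltr_wpDl.
pose g x := (N + e)^-1 * modulus f x.
have g0 x : 0 <= g x by rewrite mulr_ge0 ?modulus_ge0// invr_ge0 ltW.
have mg : measurable_fun [set: sp] g.
  by apply: measurable_funM => //; exact: measurable_cst.
exists g; split => //.
- have gE x : g x `^ p = (N + e) `^ (- p) * modulus f x `^ p.
    rewrite powRM ?modulus_ge0 ?invr_ge0 ?(ltW l0)//; congr (_ * _).
    by rewrite powRN -powR_inv1 ?(ltW l0)// powRAC powR_inv1 ?powR_ge0.
  under eq_integral do rewrite gE EFinM.
  rewrite ge0_integralZl//=; last 3 first.
  - by apply/measurable_EFinP; exact: (measurableT_comp (measurable_powR _) ma).
  - by move=> x _; rewrite lee_fin powR_ge0.
  - by rewrite lee_fin powR_ge0.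
  rewrite (integral_modulus_powR p0 fN) -EFinM lee_fin powRN mulrC.
  rewrite ler_pdivrMr ?powR_gt0// mul1r ler_powR2r ?(ltW p0)//.
  by rewrite lerDl ltW.
- move=> z; apply: le_trans (modulus_Hpar_pow_le z mR mI) _.
  rewrite EFinM -muleA lee_pmul2l ?lte_fin// mul_Hpar_int ?(ltW l0)//.
  rewrite le_eqVlt; apply/orP; left; apply/eqP; apply: eq_integral => x _.
  by rewrite /g mulrA divff ?mul1r// gt_eqF.
Qed.

Lemma bounded_of_unit_ball p q : 0 < p -> 0 < q ->
  (exists2 C : R, 0 < C & forall g : sp -> R, measurable_fun [set: sp] g ->
    (forall x, 0 <= g x) -> (\int[mu]_x (g x `^ p)%:E <= 1)%E ->
    (\int[mu]_x (T g x `^ q) <= (C `^ q)%:E)%E) ->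
  Hpar_pow_bounded d s p%:E q%:E.
Proof.
move=> p0 q0 [C C0 hC]; exists (2 * C); split; first by rewrite mulr_gt0.
move=> f [mR mI /Lp_norm_fin[N N0 fN]]; rewrite fN.
apply/lee_addgt0Pr => e e0.
have e'0 : 0 < e / (2 * C) by rewrite divr_gt0// mulr_gt0.
have [g [mg g0 gp hg]] := scaled_unit_ball p0 N0 e'0 mR mI fN.
rewrite -EFinM -EFinD.
rewrite (_ : 2 * C * N + e = 2 * (N + e / (2 * C)) * C); last first.
  by field; rewrite gt_eqF.
have l0 : 0 < 2 * (N + e / (2 * C)) by rewrite mulr_gt0// ltr_wpDl.
set l := 2 * (N + _) in hg l0 *.
apply: Lp_norm_le => //; first by rewrite mulr_ge0// ltW.
apply: (@le_trans _ _ (\int[mu]_x ((l `^ q)%:E * T g x `^ q))%E).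
  apply: ge0_integral_mono => x; first by rewrite lee_fin powR_ge0.
  rewrite -!poweR_EFin -poweRM ?lee_fin ?(ltW l0)//; last exact: Hpar_int_ge0.
  apply: gt0_ler_poweR => //; first exact: ltW.
  - by rewrite in_itv/= leey andbT lee_fin modulus_ge0.
  - by rewrite in_itv/= leey andbT mule_ge0 ?lee_fin ?(ltW l0)//; exact: Hpar_int_ge0.
rewrite ge0_integralZl//=; last 3 first.
- by apply: (measurableT_comp (measurable_poweR _)); exact: measurable_Hpar_int.
- by move=> x _; exact: poweR_ge0.
- by rewrite lee_fin powR_ge0.
rewrite powRM ?(ltW l0) ?(ltW C0)// EFinM lee_pmul2l ?lte_fin ?powR_gt0//.
exact: hC.
Qed.

Lemma bounded_infty_of_unit_ball p : 0 < p ->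
  (exists2 C : R, 0 < C & forall g : sp -> R, measurable_fun [set: sp] g ->
    (forall x, 0 <= g x) -> (\int[mu]_x (g x `^ p)%:E <= 1)%E ->
    forall z, (T g z <= C%:E)%E) ->
  Hpar_pow_bounded d s p%:E +oo%E.
Proof.
move=> p0 [C C0 hC]; exists (2 * C); split; first by rewrite mulr_gt0.
move=> f [mR mI /Lp_norm_fin[N N0 fN]]; rewrite fN.
apply/lee_addgt0Pr => e e0.
have e'0 : 0 < e / (2 * C) by rewrite divr_gt0// mulr_gt0.
have [g [mg g0 gp hg]] := scaled_unit_ball p0 N0 e'0 mR mI fN.
rewrite -EFinM -EFinD.
rewrite (_ : 2 * C * N + e = 2 * (N + e / (2 * C)) * C); last first.
  by field; rewrite gt_eqF.
have l0 : 0 < 2 * (N + e / (2 * C)) by rewrite mulr_gt0// ltr_wpDl.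
set l := 2 * (N + _) in hg l0 *.
apply: Lp_norm_infty_le => x; rewrite -lee_fin; apply: le_trans (hg x) _.
by rewrite [leRHS]EFinM lee_pmul2l ?lte_fin//; exact: hC.
Qed.

Hypothesis sn : 2 * s < n.

Lemma Hpar_pow_bounded_Lp_infty p : n / (2 * s) < p -> Hpar_pow_bounded d s p%:E +oo%E.
Proof.
move=> np; have s2 : 0 < 2 * s by rewrite mulr_gt0.
have p0 : 0 < p by apply: lt_trans np; rewrite divr_gt0// ltr0n.
apply: bounded_infty_of_unit_ball => //.
have [C C0 hC] := Hpar_int_Lp_bounded d1 s0 sn np.
by exists C => // g mg g0 gp z; exact: hC.
Qed.

Lemma Hpar_pow_bounded_infty : Hpar_pow_bounded d s +oo%E +oo%E.
Proof.
have [C C0 hC] := @Hpar_int1_bounded R d s d1 s0 sn.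
exists (2 * C); split; first by rewrite mulr_gt0.
move=> f [mR mI /Lp_norm_fin[N N0 fN]]; rewrite fN -EFinM.
have ma := measurable_modulus mR mI.
have ae : \forall x \ae mu, ((modulus f x)%:E <= N%:E)%E.
  have : (Lp_norm +oo f <= N%:E)%E by rewrite fN lexx.
  rewrite /Lp_norm unlock lebesgue_space_gt0 => /ess_supP.
  by apply: filterS => x /=; rewrite -/(modulus f x) ger0_norm ?modulus_ge0.
apply: Lp_norm_infty_le => z; rewrite -lee_fin.
apply: le_trans (modulus_Hpar_pow_le z mR mI) _.
rewrite -mulrA EFinM lee_pmul2l ?lte_fin// mulrC.
apply: (@le_trans _ _ (N%:E * T (fun=> 1%R) z)%E); last first.
  by rewrite EFinM lee_wpmul2l.
rewrite mul_Hpar_int//; apply: ae_ge0_le_integral => //.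
- by move=> x _; rewrite mule_ge0 ?Hpar_kernel_ge0// lee_fin modulus_ge0.
- exact: measurable_kernel_mul.
- by move=> x _; rewrite mule_ge0 ?Hpar_kernel_ge0// lee_fin mulr_ge0.
- by apply: measurable_kernel_mul; exact: measurable_cst.
- apply: filterS ae => x h _; rewrite mulr1 lee_wpmul2l ?Hpar_kernel_ge0//.
Qed.

Lemma Hpar_pow_bounded_L1_L1 : Hpar_pow_bounded d s 1%:E 1%:E.
Proof.
have [C C0 hC] := @Hpar_int1_bounded R d s d1 s0 sn.
apply: bounded_of_unit_ball => //; exists C => // g mg g0.
under eq_integral do rewrite powRr1//.
move=> g1; rewrite powRr1 ?(ltW C0)//.
under eq_integral do rewrite poweRe1 ?Hpar_int_ge0//.
under eq_integral do rewrite /Hpar_int.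
rewrite (@kernel_tonelli R d s s0 (fun w => g w.2))//; last first.
  exact: (measurableT_comp mg measurable_snd).
apply: (@le_trans _ _ (\int[mu]_x (C%:E * (g x)%:E))%E).
  apply: ge0_integral_mono => x.
    by apply: integral_ge0 => z _; rewrite mule_ge0 ?Hpar_kernel_ge0// lee_fin.
  rewrite /=.
  under eq_integral do rewrite -[g x]mulr1.
  by rewrite -mul_Hpar_int// muleC lee_wpmul2r// lee_fin.
rewrite ge0_integralZl//=; last 3 first.
- exact/measurable_EFinP.
- by move=> x _; rewrite lee_fin.
- by rewrite lee_fin ltW.
by rewrite -[leRHS]mule1 lee_pmul2l// lte_fin.
Qed.

(** L^1 -> L^q is dual to L^P -> L^oo for the conjugate exponent P, since the
    kernel is symmetric; and q < n/(n - 2 s) says that P > n/(2 s). *)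
Lemma Hpar_pow_bounded_L1_Lq q : 1 < q -> q < n / (n - 2 * s) ->
  Hpar_pow_bounded d s 1%:E q%:E.
Proof.
move=> q1 qn; have s2 : 0 < 2 * s by rewrite mulr_gt0.
have q0 : 0 < q by exact: lt_trans q1.
pose P := q / (q - 1).
have P0 : 0 < P by rewrite divr_gt0// subr_gt0.
have Pq : P^-1 + q^-1 = 1 by rewrite invf_div; field; rewrite gt_eqF.
have nP : n / (2 * s) < P.
  rewrite /P ltr_pdivrMr// mulrAC ltr_pdivlMr ?subr_gt0//.
  by move: qn; rewrite ltr_pdivlMr ?subr_gt0// => qn; lra.
have [C C0 hC] := Hpar_int_Lp_bounded d1 s0 sn nP.
apply: bounded_of_unit_ball => //; exists C => // g mg g0 g1.
have {}g1 : (\int[mu]_x (g x)%:E <= 1)%E.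
  by apply: le_trans g1; under [leRHS]eq_integral do rewrite powRr1//.
apply: (dual_Lq_bound q1 Pq (ltW C0)).
- exact: measurable_Hpar_int.
- by move=> z; exact: Hpar_int_ge0.
move=> h mh h0 hP.
have -> : (\int[mu]_x (T g x * (h x)%:E) = \int[mu]_x ((g x)%:E * T h x))%E.
  transitivity (\int[mu]_z \int[mu]_x (K z x * (h z * g x)%:E))%E.
    by apply: eq_integral => z _; rewrite muleC mul_Hpar_int.
  rewrite (@kernel_tonelli R d s s0 (fun w => h w.1 * g w.2)).
  - by apply: eq_integral => x _; rewrite mul_Hpar_int//; apply: eq_integral => z _;
       rewrite /= mulrC.
  - by apply: measurable_funM; [exact: (measurableT_comp mh measurable_fst)|
      exact: (measurableT_comp mg measurable_snd)].
  - by move=> w; rewrite mulr_ge0.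
apply: (@le_trans _ _ (\int[mu]_x (C%:E * (g x)%:E))%E).
  apply: ge0_integral_mono => x; first by rewrite mule_ge0 ?lee_fin ?Hpar_int_ge0.
  by rewrite muleC lee_wpmul2r ?lee_fin//; exact: hC.
rewrite ge0_integralZl//=; last 3 first.
- exact/measurable_EFinP.
- by move=> x _; rewrite lee_fin.
- by rewrite lee_fin ltW.
by rewrite -[leRHS]mule1 lee_pmul2l// lte_fin.
Qed.

(** The kernel is dominated by the Riesz kernel of any order b <= 2 s, in
    particular of the order that scaling imposes on an L^p -> L^q bound. *)
Lemma Hpar_pow_bounded_Lp_Lq p q : 1 < p -> 1 < q ->
  p^-1 - 2 * s / n <= q^-1 -> q^-1 < p^-1 -> Hpar_pow_bounded d s p%:E q%:E.
Proof.
move=> p1 q1 pq1 pq2.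
have p0 : 0 < p by exact: lt_trans p1.
have q0 : 0 < q by exact: lt_trans q1.
have n0 : 0 < n by rewrite ltr0n.
pose b := n * (p^-1 - q^-1).
have b0 : 0 < b by rewrite mulr_gt0// subr_gt0.
have bs : b <= 2 * s.
  by rewrite /b mulrC -ler_pdivlMr// lerBlDr -lerBlDl.
pose P := (1 - q^-1)^-1.
have qi : q^-1 < 1 by rewrite invf_lt1.
have pi1 : p^-1 < 1 by rewrite invf_lt1.
have qi0 : 0 < q^-1 by rewrite invr_gt0.
have Pi0 : 0 < 1 - q^-1 by rewrite subr_gt0.
have P0 : 0 < P by rewrite invr_gt0.
have P1 : 1 < P by rewrite invf_gt1//; lra.
have Pi : P^-1 = 1 - q^-1 by rewrite invrK.
have Pq : P^-1 + q^-1 = 1 by rewrite Pi subrK.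
have Pb : P * b < n.
  by rewrite mulrC -ltr_pdivlMr// Pi /b ltr_pM2l//; lra.
have pb : p * b < n.
  by rewrite mulrC -ltr_pdivlMr// /b ltr_pM2l//; lra.
have E : P^-1 + p^-1 = 1 + b / n.
  by rewrite /b mulrAC divff ?gt_eqF// mul1r Pi; lra.
have [C C0 hC] := Hpar_bilinear_le d1 s0 sn b0 bs P1 p1 pb Pb E.
apply: bounded_of_unit_ball => //; exists C => // g mg g0 gp.
apply: (dual_Lq_bound q1 Pq (ltW C0)).
- exact: measurable_Hpar_int.
- by move=> z; exact: Hpar_int_ge0.
move=> h mh h0 hP.
by under eq_integral do rewrite muleC; exact: hC.
Qed.

End boundedness.

(** * Lower bound for the kernel near the origin *)

Section kernel_lower_bound.
Context {R : realType} {d : nat}.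
Local Notation rT := (measurableTypeR R).
Local Notation sp := (space R d).
Local Notation n := (d.+1%:R : R).

Definition origin : sp := (0 : R, [tuple of nseq d (0 : R)]).

Lemma cube_originP z r : cube origin r z <->
  `|(z.1 : R)| <= r /\ (forall i, `|tnth z.2 i| <= r).
Proof.
rewrite /cube /box /=; split => -[h1 h2]; split => [|i].
- by move: h1; rewrite /= sub0r normrN.
- by have := h2 i; rewrite tnth_nseq sub0r normrN.
- by rewrite /= sub0r normrN.
- by rewrite tnth_nseq sub0r normrN; exact: h2.
Qed.

Lemma cube_origin_diff z z' r : cube origin r z -> cube origin r z' -> cube z (2 * r) z'.
Proof.
move=> /cube_originP[h1 h2] /cube_originP[h1' h2']; split => [|i] /=.
  by rewrite (le_trans (ler_normB _ _))// mulr_natl mulr2n lerD.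
by rewrite (le_trans (ler_normB _ _))// mulr_natl mulr2n lerD ?h2 ?h2'.
Qed.

Lemma sqsum_cube_origin_le z z' : cube origin 1 z -> cube origin 1 z' ->
  sqsum z.2 z'.2 <= 4 * d%:R.
Proof.
move=> /cube_originP[_ h2] /cube_originP[_ h2'].
rewrite /sqsum mulrC mulr_natl -[X in _ *+ X]card_ord -sumr_const ler_sum// => i _.
rewrite -[leLHS]real_normK ?num_real// (_ : 4 = 2 ^+ 2); last by ring.
rewrite ler_sqr ?nnegrE// (le_trans (ler_normD _ _))//.
by rewrite (_ : 2 = 1 + 1)// lerD ?h2 ?h2'.
Qed.

(** On the diffusive time scale t ~ delta^2 the heat kernel is at least of
    order delta^-(d+1) throughout the cube of size delta: the exponent of the
    Gaussian factor stays bounded there. *)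
Lemma heat_kernel_ge : exists2 c : R, 0 < c & forall (t delta : R) (z z' : sp),
  0 < delta -> delta <= 1 -> delta ^+ 2 <= t -> t <= 2 * delta ^+ 2 ->
  cube origin delta z -> cube origin delta z' ->
  c * t `^ (- (n / 2)) <= heat_kernel t z z'.
Proof.
set c0 : R := 2 `^ (- (d.+2%:R / 2)) * pi `^ (- (d.+1%:R / 2)).
have c00 : 0 < c0 by rewrite mulr_gt0// powR_gt0// pi_gt0.
pose M : R := d%:R * expR 4 + d%:R + 1.
pose c1 : R := (2 * expR 4) `^ (- (d%:R / 2)).
have c10 : 0 < c1 by rewrite powR_gt0// mulr_gt0// expR_gt0.
exists (c0 * c1 * expR (- M)); first by rewrite mulr_gt0 ?expR_gt0// mulr_gt0.
move=> t delta z z' de0 de1 dt td zQ zQ'.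
have de2 : 0 < delta ^+ 2 by rewrite exprn_gt0.
have t0 : 0 < t by exact: lt_le_trans dt.
have t2 : t <= 2.
  by rewrite (le_trans td)// -[leRHS]mulr1 ler_pM2l// exprn_ile1// ltW.
rewrite /heat_kernel -/c0 mulrAC; apply: ler_pM; rewrite ?expR_ge0//.
- by rewrite !mulr_ge0 ?powR_ge0 ?(ltW c00) ?(ltW c10).
- have d2 : 0 <= d%:R / 2 :> R by rewrite divr_ge0.
  apply: (@le_trans _ _ (c0 * t `^ (- (1 / 2)) * (2 * expR 4 * t) `^ (- (d%:R / 2)))).
    have -> : - (n / 2) = - (1 / 2) + - (d%:R / 2) :> R by rewrite -natr1; field.
    rewrite powRD; last by rewrite (gt_eqF t0) implybT.
    rewrite [in leRHS]powRM ?mulr_ge0 ?expR_ge0 ?(ltW t0)// -/c1.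
    by rewrite [leRHS](_ : _ = c0 * c1 * (t `^ (- (1 / 2)) * t `^ (- (d%:R / 2)))) ?lexx//; ring.
  rewrite ler_wpM2l ?mulr_ge0 ?powR_ge0 ?(ltW c00)//.
  apply: ler_powRN2r => //; first by rewrite sinh_gt0// mulr_gt0.
  by rewrite sinh_double_le// ltW.
- rewrite ler_expR coth_double_sub_tanh//.
  have [h1 h2] := cube_sqdist (cube_origin_diff zQ zQ').
  have h3 : sqsum z.2 z'.2 <= 4 * d%:R.
    by apply: sqsum_cube_origin_le; [exact: subset_cube zQ|exact: subset_cube zQ'].
  have /andP[th0 th1] := tanh_le1 (ltW t0).
  have hc := coth_le t0 t2.
  have co0 : 0 <= coth t by rewrite ltW// divr_gt0 ?sinh_gt0 ?cosh_gt0.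
  have s0 : 0 <= sqsum z.2 z'.2 by apply: sumr_ge0 => i _; exact: sqr_ge0.
  have e1 : ((z.1 : R) - (z'.1 : R)) ^+ 2 / (4 * t) <= 1.
    by rewrite ler_pdivrMr ?mulr_gt0// mul1r (le_trans h1)// exprMn; lra.
  have e2 : 1 / 4 * coth t * sqdist z.2 z'.2 <= d%:R * expR 4.
    apply: (@le_trans _ _ (1 / 4 * coth t * (d%:R * (4 * t)))).
      apply: ler_wpM2l; first by rewrite mulr_ge0// divr_ge0.
      by rewrite (le_trans h2)// ler_wpM2l// exprMn; lra.
    rewrite [leLHS](_ : _ = d%:R * (t * coth t)); last by field.
    by rewrite ler_wpM2l.
  have e3 : tanh t / 4 * sqsum z.2 z'.2 <= d%:R.
    apply: (@le_trans _ _ (1 / 4 * (4 * d%:R))).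
      by apply: ler_pM => //; [rewrite divr_ge0|rewrite ler_pM2r// invr_gt0].
    by rewrite mulrA mul1r mulVf// mul1r lexx.
  rewrite /M; lra.
Qed.

(** Times t in [delta^2, 2 delta^2] already give the size of the Riesz kernel
    of order 2 s. *)
Lemma Hpar_kernel_ge (s : R) : 0 < s -> 2 * s < n ->
  exists2 c : R, 0 < c & forall (delta : R) (z z' : sp), 0 < delta -> delta <= 1 ->
    cube origin delta z -> cube origin delta z' ->
    ((c * delta `^ (2 * s - n))%:E <= Hpar_kernel s z z')%E.
Proof.
move=> s0 sn; have [c c0 hc] := heat_kernel_ge.
have G0 := Gamma_gt0 s0.
pose e := s - 1 - n / 2; have e0 : 0 < - e by rewrite /e; lra.
exists ((Gamma s)^-1 * (c * 2 `^ e)); first by rewrite mulr_gt0 ?invr_gt0// mulr_gt0// powR_gt0.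
move=> delta z z' de0 de1 zQ zQ'; rewrite /Hpar_kernel -mulrA EFinM lee_pmul2l ?lte_fin ?invr_gt0//.
have de2 : 0 < delta ^+ 2 by rewrite exprn_gt0.
have mh D : measurable_fun (D : set rT) (fun t => (t `^ (s - 1) * heat_kernel t z z')%:E).
  apply/measurable_EFinP/measurable_funTS; apply: measurable_funM; first exact: measurable_powR.
  by apply: measurable_heat_kernel; [exact: measurable_id|exact: measurable_cst..].
apply: (@le_trans _ _ (\int[lebesgue_measure]_(t in `[(delta ^+ 2)%R, (2 * delta ^+ 2)%R])
    (c * (2 * delta ^+ 2) `^ e)%:E)%E).
  rewrite integral_cst//= lebesgue_measure_itv/= lte_fin.
  rewrite (_ : (_ < _) = true); last by apply/idP; lra.
  rewrite -EFinD -EFinM lee_fin le_eqVlt; apply/orP; left; apply/eqP.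
  have -> : delta `^ (2 * s - n) = (delta ^+ 2) `^ e * delta ^+ 2.
    rewrite -{2}(powRr1 (ltW de2)) -powRD; last by rewrite (gt_eqF de2) implybT.
    by rewrite -powR_mulrn ?(ltW de0)// -powRrM; congr (_ `^ _); rewrite /e; field.
  by rewrite powRM ?(ltW de2)//; ring.
apply: (@le_trans _ _ (\int[lebesgue_measure]_(t in `[(delta ^+ 2)%R, (2 * delta ^+ 2)%R])
    (t `^ (s - 1) * heat_kernel t z z')%:E)%E).
  apply: ge0_le_integral => //.
  - by move=> t _; rewrite lee_fin mulr_ge0 ?powR_ge0// ltW.
  - move=> t; rewrite /= in_itv/= => /andP[t1 t2].
    have t0 : 0 < t by exact: lt_le_trans t1.
    rewrite lee_fin; apply: (@le_trans _ _ (t `^ (s - 1) * (c * t `^ (- (n / 2))))); last first.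
      by rewrite ler_wpM2l ?powR_ge0//; exact: (hc t delta).
    rewrite [leRHS]mulrCA -powRD ?(gt_eqF t0) ?implybT// -/e ler_pM2l//.
    by rewrite -[e]opprK; apply: ler_powRN2r => //; exact: ltW.
apply: ge0_subset_integral => //.
- by move=> t _; rewrite lee_fin mulr_ge0 ?powR_ge0 ?heat_kernel_ge0.
- move=> t; rewrite /= !in_itv/= andbT => /andP[t1 _].
  exact: lt_le_trans t1.
Qed.

End kernel_lower_bound.

(** * Failure of boundedness *)

Section necessity.
Context {R : realType} {d : nat}.
Local Notation sp := (space R d).
Local Notation mu := (@lebesgue_space R d).
Local Notation n := (d.+1%:R : R).
Variable s : R.
Hypotheses (d1 : (1 <= d)%N) (s0 : 0 < s) (sn : 2 * s < n).
Local Notation K := (@Hpar_kernel R d s).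
Local Notation T := (@Hpar_int R d s).

Definition dyadic (k : nat) : R := 2^-1 ^+ k.
Definition dyadic_cube (k : nat) : set sp := cube origin (dyadic k).

Lemma dyadic_gt0 k : 0 < dyadic k.
Proof. by rewrite exprn_gt0// invr_gt0. Qed.

Lemma dyadic_le i j : (i <= j)%N -> dyadic j <= dyadic i.
Proof.
by move=> ij; apply: ler_wiXn2l => //; rewrite ?invr_ge0// invf_le1// ler1n.
Qed.

Lemma dyadic_le1 k : dyadic k <= 1.
Proof. by have := @dyadic_le 0 k (leq0n k); rewrite {2}/dyadic expr0. Qed.

Lemma dyadic_powRN k a : dyadic k `^ (- a) = (2 `^ a) ^+ k.
Proof.
rewrite /dyadic -[2^-1 ^+ k]powR_mulrn ?invr_ge0// powRAC powR_mulrn ?powR_ge0//.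
by have -> : 2^-1 `^ (- a) = 2 `^ a :> R by rewrite -powR_inv1// -powRrM mulN1r opprK.
Qed.

Lemma measurable_dyadic_cube k : measurable (dyadic_cube k).
Proof. exact: measurable_cube. Qed.

Lemma dyadic_cube_sub i j : (i <= j)%N -> dyadic_cube j `<=` dyadic_cube i.
Proof. by move=> ij; apply: subset_cube; exact: dyadic_le. Qed.

(** A truncation of the radial function |z|^(-a), up to constants. *)
Definition peak (a : R) (N : nat) (z : sp) : R :=
  \sum_(j < N) dyadic j `^ (- a) * \1_(dyadic_cube j) z.

Lemma peak_ge0 a N z : 0 <= peak a N z.
Proof. by apply: sumr_ge0 => j _; rewrite mulr_ge0// powR_ge0. Qed.

Lemma measurable_peak a N : measurable_fun [set: sp] (peak a N).
Proof.
apply: measurable_sum => j; apply: measurable_funM; first exact: measurable_cst.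
by apply: measurable_indic; exact: measurable_dyadic_cube.
Qed.

Lemma peak_le_sum a N z : peak a N z <= \sum_(j < N) dyadic j `^ (- a).
Proof.
by apply: ler_sum => j _; rewrite ler_piMr ?powR_ge0.
Qed.

Lemma peak_ge_term a N z m : (m < N)%N -> dyadic_cube m z -> dyadic m `^ (- a) <= peak a N z.
Proof.
move=> mN zm; rewrite /peak (bigD1 (Ordinal mN))//= indicE mem_set// mulr1 lerDl.
by apply: sumr_ge0 => j _; rewrite mulr_ge0// powR_ge0.
Qed.

(** Since the weights grow geometrically, the smallest cube that contains z
    determines the size of the sum. *)
Lemma peak_le a : 0 < a -> exists2 C : R, 0 < C & forall N z,
  peak a N z = 0 \/ exists m, [/\ (m < N)%N, dyadic_cube m z &
                                 peak a N z <= C * dyadic m `^ (- a)].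
Proof.
move=> a0; pose x : R := 2 `^ a.
have x1 : 1 < x.
  have {1}<- : 1 `^ a = 1 :> R by rewrite powR1.
  by apply: gt0_ltr_powR => //; rewrite ?nnegrE// ltr1n.
have x10 : 0 < x - 1 by rewrite subr_gt0.
exists (x / (x - 1)); first by rewrite divr_gt0// (lt_trans ltr01).
move=> N z; elim: N => [|N IH]; first by left; rewrite /peak big_ord0.
have [zN|zN] := pselect (dyadic_cube N z); last first.
  rewrite {1}/peak big_ord_recr/= indicE memNset// mulr0 addr0.
  case: IH => [|[m [mN zm h]]]; [by left|right]; exists m; split => //.
    exact: ltnW.
  by rewrite /peak big_ord_recr/= indicE memNset// mulr0 addr0.
right; exists N; split => //.
apply: le_trans (peak_le_sum _ _ _) _.
under eq_bigr do rewrite dyadic_powRN -/x.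
rewrite dyadic_powRN -/x mulrAC -exprS ler_pdivlMr// mulrC -subrX1.
by rewrite gerBl.
Qed.

Lemma lebesgue_dyadic_cube k : mu (dyadic_cube k) = ((2 * dyadic k) ^+ d.+1)%:E.
Proof. by rewrite lebesgue_cube// ltW// dyadic_gt0. Qed.

(** At the critical exponent every scale has the same mass: the truncations
    of |z|^-(d+1) diverge logarithmically. *)
Lemma integral_peak N :
  (\int[mu]_z (peak n N z)%:E = (N%:R * 2 ^+ d.+1)%:E)%E.
Proof.
rewrite /peak; under eq_integral do rewrite -sumEFin.
rewrite ge0_integral_sum//; first last.
- by move=> j z _; rewrite lee_fin mulr_ge0// powR_ge0.
- move=> j; apply/measurable_EFinP; apply: measurable_funM; first exact: measurable_cst.
  by apply: measurable_indic; exact: measurable_dyadic_cube.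
rewrite (eq_bigr (fun=> (2 ^+ d.+1)%:E)) => [|j _].
  by rewrite sumEFin sumr_const card_ord mulr_natl.
under eq_integral do rewrite EFinM.
rewrite ge0_integralZl//=; last 2 first.
- apply/measurable_EFinP.
  by apply: measurable_indic; exact: measurable_dyadic_cube.
- by rewrite lee_fin powR_ge0.
rewrite integral_indic ?setIT//; last exact: measurable_dyadic_cube.
have -> : (dyadic j `^ (- n))%:E = ((dyadic j ^+ d.+1)^-1)%:E.
  by rewrite powRN powR_mulrn// ltW// dyadic_gt0.
apply: (@etrans _ _ (((dyadic j ^+ d.+1)^-1)%:E * ((2 * dyadic j) ^+ d.+1)%:E)%E).
  by congr (_ * _)%E; exact: lebesgue_dyadic_cube.
rewrite -EFinM; congr EFin; rewrite exprMn mulrCA mulVf ?mulr1//.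
by rewrite expf_neq0// gt_eqF// dyadic_gt0.
Qed.

Lemma Hpar_int_dyadic_cube_ge : exists2 c : R, 0 < c & forall k j z, (k <= j)%N ->
  dyadic_cube k z ->
  ((c * dyadic k `^ (2 * s - n) * (2 * dyadic j) ^+ d.+1)%:E <=
    T (\1_(dyadic_cube j)) z)%E.
Proof.
have [c c0 hc] := @Hpar_kernel_ge R d s s0 sn.
exists c => // k j z kj zk.
rewrite -(integral_cst_cube origin) ?(ltW (dyadic_gt0 j))//.
rewrite [leLHS]integral_mkcond; apply: ge0_le_integral => //.
- move=> x _; rewrite patchE; case: ifP => // _.
  by rewrite lee_fin mulr_ge0 ?powR_ge0// ltW.
- apply/(measurable_restrictT _ _).1; first exact: measurable_cube.
  exact: measurable_cst.
- by apply: measurable_kernel_mul; apply: measurable_indic; exact: measurable_cube.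
move=> x _; rewrite patchE indicE; case: ifPn => [xj|_]; last by rewrite mule0.
rewrite mule1; apply: hc; rewrite ?dyadic_gt0 ?dyadic_le1//.
by apply: (dyadic_cube_sub kj); exact: set_mem.
Qed.

Section test_functions.
Variables (phi : sp -> R) (B : R).
Hypotheses (mphi : measurable_fun [set: sp] phi) (phiB : forall x, 0 <= phi x <= B).

Definition real_fun : sp -> R[i] := fun x => Complex (phi x) 0.

Let phi0 x : 0 <= phi x. Proof. by case/andP: (phiB x). Qed.

Lemma modulus_real_fun : modulus real_fun = phi.
Proof.
by apply/funext => x; rewrite modulusE /= expr0n /= addr0 sqrtr_sqr ger0_norm.
Qed.

(** Finiteness guarantees that Hpar_pow really takes this value at phi. *)
Lemma Hpar_int_fin_num z : T phi z \is a fin_num.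
Proof.
have [C C0 hC] := @Hpar_int1_bounded R d s d1 s0 sn.
have B0 : 0 <= B by case/andP: (phiB z) => /le_trans; exact.
rewrite ge0_fin_numE; last exact: Hpar_int_ge0.
apply: (@le_lt_trans _ _ (B%:E * T (fun=> 1%R) z)%E).
  rewrite mul_Hpar_int//; apply: ge0_le_integral => //.
  - by move=> x _; rewrite mule_ge0 ?Hpar_kernel_ge0// lee_fin.
  - exact: measurable_kernel_mul.
  - by apply: measurable_kernel_mul; exact: measurable_cst.
  - move=> x _; rewrite lee_wpmul2l ?Hpar_kernel_ge0// lee_fin mulr1.
    by case/andP: (phiB x).
by rewrite lte_mul_pinfty// (le_lt_trans (hC z)) ?ltry.
Qed.

Lemma Hpar_int_le_modulus z : (T phi z <= (modulus (Hpar_pow s real_fun) z)%:E)%E.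
Proof.
rewrite -(fineK (Hpar_int_fin_num z)) lee_fin.
apply: le_trans (Re_le_modulus (Hpar_pow s real_fun) z).
exact: ler_norm.
Qed.

Lemma real_fun_in_Lp p (N : R) : 0 < p -> 0 <= N ->
  (\int[mu]_x (phi x `^ p)%:E <= (N `^ p)%:E)%E ->
  in_Lp p%:E real_fun /\ (Lp_norm p%:E real_fun <= N%:E)%E.
Proof.
move=> p0 N0 h.
have hN : (Lp_norm p%:E real_fun <= N%:E)%E.
  by apply: Lp_norm_le => //; rewrite modulus_real_fun.
split => //; split => //=.
exact: le_lt_trans hN (ltry _).
Qed.

End test_functions.

Lemma test_Lq p q : 0 < p -> 0 < q -> Hpar_pow_bounded d s p%:E q%:E ->
  exists2 C : R, 0 < C & forall (phi : sp -> R) (B N : R), measurable_fun [set: sp] phi ->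
    (forall x, 0 <= phi x <= B) -> 0 <= N ->
    (\int[mu]_x (phi x `^ p)%:E <= (N `^ p)%:E)%E ->
    (\int[mu]_x (T phi x `^ q) <= ((C * N) `^ q)%:E)%E.
Proof.
move=> p0 q0 [C [C0 hC]]; exists C => // phi B N mphi phiB N0 hN.
have [hp hpN] := real_fun_in_Lp mphi phiB p0 N0 hN.
have CN : (Lp_norm q%:E (Hpar_pow s (real_fun phi)) <= (C * N)%:E)%E.
  by apply: le_trans (hC _ hp) _; rewrite EFinM lee_pmul2l// lte_fin.
apply: (@le_trans _ _ (\int[mu]_x (modulus (Hpar_pow s (real_fun phi)) x `^ q)%:E)%E).
  apply: ge0_integral_mono => x; first exact: poweR_ge0.
  rewrite -poweR_EFin; apply: gt0_ler_poweR; rewrite ?(ltW q0)//.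
  - rewrite in_itv/= leey andbT; apply: Hpar_int_ge0 => // y.
    by case/andP: (phiB y).
  - by rewrite in_itv/= leey andbT lee_fin modulus_ge0.
  - exact: Hpar_int_le_modulus mphi phiB x.
move: CN; rewrite Lp_normE ?gt_eqF//; set I := integral _ _ _ => CN.
have I0 : (0 <= I)%E by apply: integral_ge0 => x _; rewrite lee_fin powR_ge0.
have -> : I = ((I `^ q^-1) `^ q)%E by rewrite -poweRrM mulVf ?gt_eqF// poweRe1.
rewrite -poweR_EFin; apply: gt0_ler_poweR; rewrite ?(ltW q0)//.
- by rewrite in_itv/= leey andbT poweR_ge0.
- by rewrite in_itv/= leey andbT lee_fin mulr_ge0// ltW.
Qed.

Lemma test_infty p : 0 < p -> Hpar_pow_bounded d s p%:E +oo%E ->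
  exists2 C : R, 0 < C & forall (phi : sp -> R) (B N : R), measurable_fun [set: sp] phi ->
    (forall x, 0 <= phi x <= B) -> 0 <= N ->
    (\int[mu]_x (phi x `^ p)%:E <= (N `^ p)%:E)%E ->
    forall k, exists2 z, dyadic_cube k z & (T phi z <= (C * N)%:E)%E.
Proof.
move=> p0 [C [C0 hC]]; exists C => // phi B N mphi phiB N0 hN k.
have [hp hpN] := real_fun_in_Lp mphi phiB p0 N0 hN.
have CN : (Lp_norm +oo%E (Hpar_pow s (real_fun phi)) <= (C * N)%:E)%E.
  by apply: le_trans (hC _ hp) _; rewrite EFinM lee_pmul2l// lte_fin.
move: CN; rewrite /Lp_norm unlock lebesgue_space_gt0 => /ess_supP[A [mA A0 hA]].
apply: contrapT => hz.
have : (mu (dyadic_cube k) <= mu A)%E.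
  apply: le_measure; rewrite ?inE//; first exact: measurable_dyadic_cube.
  move=> z zk; apply: hA => /= h; apply: hz; exists z => //.
  apply: le_trans (Hpar_int_le_modulus mphi phiB z) _.
  by move: h; rewrite ger0_norm //; exact: modulus_ge0.
rewrite lebesgue_dyadic_cube.
have -> : mu A = 0%E by exact: A0.
by rewrite lee_fin leNgt exprn_gt0// mulr_gt0// dyadic_gt0.
Qed.

Lemma nat_unbounded (C : R) : exists N : nat, C < N.+1%:R.
Proof. by exists (Num.truncn C); exact: truncnS_gt. Qed.

Lemma powR_nat_le_absurd (c e : R) : 0 < c -> 0 < e ->
  ~ (forall N : nat, c * N.+1%:R <= (N.+1%:R) `^ (1 - e)).
Proof.
move=> c0 e0 h.
have [N hN] := nat_unbounded ((c^-1) `^ (e^-1)).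
have N0 : 0 < N.+1%:R :> R by rewrite ltr0n.
have := h N; rewrite powRB ?(gt_eqF N0) ?implybT// powRr1 ?ler0n// mulrC.
rewrite ler_pM2l//; apply/negP; rewrite -ltNge.
rewrite invf_plt ?posrE ?powR_gt0//.
have -> : c^-1 = (c^-1 `^ e^-1) `^ e.
  by rewrite -powRrM mulVf ?gt_eqF// powRr1// invr_ge0 ltW.
by apply: gt0_ltr_powR; rewrite ?nnegrE ?powR_ge0// ler0n.
Qed.

Lemma indic_cube_bounds k x : 0 <= (\1_(dyadic_cube k) x : R) <= 1.
Proof. by rewrite indicE; case: (_ \in _) => /=; rewrite ?ler01 ?lexx. Qed.

Lemma integral_indic_cube k :
  (\int[mu]_x ((\1_(dyadic_cube k) x : R) `^ 1)%:E =
    (((2 * dyadic k) ^+ d.+1) `^ 1)%:E)%E.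
Proof.
have v0 : 0 <= (2 * dyadic k) ^+ d.+1.
  by rewrite exprn_ge0// mulr_ge0// ltW// dyadic_gt0.
under eq_integral do rewrite powRr1//.
rewrite powRr1// integral_indic ?setIT//; last exact: measurable_dyadic_cube.
exact: lebesgue_dyadic_cube.
Qed.

(** The indicator of a cube of size delta, divided by its mass, is sent to a
    function of size at least c delta^(2 s - n) on that cube. *)
Lemma Hpar_pow_unbounded_L1_infty : ~ Hpar_pow_bounded d s 1%:E +oo%E.
Proof.
move=> /(test_infty ltr01)[C C0 hC].
have [c c0 hc] := Hpar_int_dyadic_cube_ge.
have e0 : 0 < n - 2 * s by rewrite subr_gt0.
have h k : c * dyadic k `^ (- (n - 2 * s)) <= C.
  pose v := (2 * dyadic k) ^+ d.+1.
  have v0 : 0 < v by rewrite exprn_gt0// mulr_gt0// dyadic_gt0.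
  have hv : (\int[mu]_x ((\1_(dyadic_cube k) x : R) `^ 1)%:E <= (v `^ 1)%:E)%E.
    by rewrite integral_indic_cube.
  have [z zk hz] := hC \1_(dyadic_cube k) 1 v
    (measurable_indic (measurable_dyadic_cube k)) (indic_cube_bounds k) (ltW v0) hv k.
  have := le_trans (hc k k z (leqnn k) zk) hz.
  by rewrite lee_fin ler_pM2r// opprB.
have [N hN] := nat_unbounded ((C / c) `^ ((n - 2 * s)^-1)).
have := h N.+1; rewrite dyadic_powRN -powR_mulrn ?powR_ge0// powRAC powR_mulrn//.
apply/negP; rewrite -ltNge mulrC -ltr_pdivrMr//.
have -> : C / c = ((C / c) `^ (n - 2 * s)^-1) `^ (n - 2 * s).
  by rewrite -powRrM mulVf ?gt_eqF// powRr1// divr_ge0 ?ltW.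
apply: gt0_ltr_powR; rewrite ?nnegrE ?powR_ge0 ?exprn_ge0//.
by apply: (lt_le_trans hN); rewrite -natrX ler_nat ltnW// ltn_expl.
Qed.

(** The image of a normalised bump at scale 2^-N exceeds c |z|^(2 s - n) down
    to that scale, and the q-th power of this function is not integrable at 0
    in the limit N -> oo. *)
Lemma Hpar_pow_unbounded_L1_Lq q : 0 < q -> n <= (n - 2 * s) * q ->
  ~ Hpar_pow_bounded d s 1%:E q%:E.
Proof.
move=> q0 nq /(test_Lq ltr01 q0)[C C0 hC].
have [c c0 hc] := Hpar_int_dyadic_cube_ge.
have n0 : 0 < n by rewrite ltr0n.
have [D D0 hD] := peak_le n0.
have h (N : nat) : N.+1%:R * 2 ^+ d.+1 * c `^ q <= D * C `^ q.
  pose v := (2 * dyadic N) ^+ d.+1.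
  have v0 : 0 < v by rewrite exprn_gt0// mulr_gt0// dyadic_gt0.
  have hv : (\int[mu]_x ((\1_(dyadic_cube N) x : R) `^ 1)%:E <= (v `^ 1)%:E)%E.
    by rewrite integral_indic_cube.
  have mI := measurable_indic (measurable_dyadic_cube N) : measurable_fun setT (\1_(dyadic_cube N) : sp -> R).
  have I0 x : 0 <= \1_(dyadic_cube N) x :> R by case/andP: (indic_cube_bounds N x).
  have hT := hC \1_(dyadic_cube N) 1 v mI (indic_cube_bounds N) (ltW v0) hv.
  have cv0 : 0 < (c * v) `^ q by rewrite powR_gt0// mulr_gt0.
  have ptw z : (((c * v) `^ q)%:E * (peak n N.+1 z)%:E <= D%:E * T \1_(dyadic_cube N) z `^ q)%E.
    have [->|[m [mN zm hm]]] := hD N.+1 z.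
      by rewrite mule0 mule_ge0 ?poweR_ge0// lee_fin ltW.
    apply: (@le_trans _ _ (((c * v) `^ q)%:E * (D * dyadic m `^ (- n))%:E)%E).
      by rewrite lee_pmul2l ?lte_fin// lee_fin.
    rewrite EFinM muleCA lee_pmul2l ?lte_fin//.
    apply: (@le_trans _ _ ((c * dyadic m `^ (2 * s - n) * v) `^ q)%:E).
      rewrite -EFinM lee_fin mulrAC [leRHS]powRM ?mulr_ge0 ?powR_ge0 ?(ltW c0) ?(ltW v0)//.
      rewrite ler_wpM2l ?powR_ge0// -powRrM; apply: ger_powR.
        by rewrite dyadic_gt0 dyadic_le1.
      by rewrite -opprB mulNr lerN2.
    rewrite -poweR_EFin; apply: gt0_ler_poweR; rewrite ?(ltW q0)//.
    - by rewrite in_itv/= leey andbT lee_fin !mulr_ge0 ?powR_ge0// ltW.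
    - by rewrite in_itv/= leey andbT; exact: Hpar_int_ge0.
    - exact: hc.
  have : (\int[mu]_z (((c * v) `^ q)%:E * (peak n N.+1 z)%:E) <=
          \int[mu]_z (D%:E * T \1_(dyadic_cube N) z `^ q))%E.
    apply: ge0_integral_mono => // z.
    by rewrite -EFinM lee_fin mulr_ge0 ?powR_ge0 ?peak_ge0.
  rewrite [X in (X <= _)%E -> _](_ : _ = (((c * v) `^ q)%:E * (N.+1%:R * 2 ^+ d.+1)%:E)%E); last first.
    rewrite -integral_peak ge0_integralZl//=.
    - by apply/measurable_EFinP; exact: measurable_peak.
    - by move=> z _; rewrite lee_fin peak_ge0.
    - by rewrite lee_fin ltW.
  rewrite [X in (_ <= X)%E -> _](_ : _ = (D%:E * \int[mu]_z (T \1_(dyadic_cube N) z `^ q))%E); last first.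
    rewrite ge0_integralZl//=.
    - by apply: (measurableT_comp (measurable_poweR _)); exact: measurable_Hpar_int.
    - by move=> z _; exact: poweR_ge0.
    - by rewrite lee_fin ltW.
  move=> h1; have := le_trans h1 (lee_wpmul2l (ltW D0 : (0 <= D%:E)%E) hT).
  rewrite -!EFinM lee_fin !powRM ?(ltW c0) ?(ltW v0) ?(ltW C0)//.
  by rewrite mulrAC [leRHS]mulrA ler_pM2r ?powR_gt0// [leLHS]mulrC.
have w0 : 0 < 2 ^+ d.+1 * c `^ q by rewrite mulr_gt0 ?powR_gt0// exprn_gt0.
have [N hN] := nat_unbounded (D * C `^ q / (2 ^+ d.+1 * c `^ q)).
by have := h N; rewrite -mulrA -ler_pdivlMr// leNgt hN.
Qed.

(** For truncations of |z|^(-2 s) each of the N scales contributes a constant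
    to the value near 0, so the image is of size N there, whereas the L^p norm
    is O(N^(1/p)). *)
Lemma Hpar_pow_unbounded_Lp_infty p : 1 < p -> p * (2 * s) <= n ->
  ~ Hpar_pow_bounded d s p%:E +oo%E.
Proof.
move=> p1 pn; have p0 : 0 < p by exact: lt_trans p1.
move=> /(test_infty p0)[C C0 hC].
have [c c0 hc] := Hpar_int_dyadic_cube_ge.
have s2 : 0 < 2 * s by rewrite mulr_gt0.
have n0 : 0 < n by rewrite ltr0n.
have [D D0 hD] := peak_le s2.
have w0 : 0 < 2 ^+ d.+1 :> R by rewrite exprn_gt0.
have h (N : nat) : N.+1%:R * (c * 2 ^+ d.+1) <= C * (D * (N.+1%:R * 2 ^+ d.+1) `^ p^-1).
  have X0 : 0 <= N.+1%:R * 2 ^+ d.+1 :> R by rewrite mulr_ge0// ltW.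
  pose phi := peak (2 * s) N.+1.
  have mphi : measurable_fun [set: sp] phi by exact: measurable_peak.
  have phiB x : 0 <= phi x <= \sum_(j < N.+1) dyadic j `^ (- (2 * s)).
    by rewrite peak_ge0 peak_le_sum.
  have ptw x : phi x `^ p <= D `^ p * peak n N.+1 x.
    have [e|[m [mN xm hm]]] := hD N.+1 x.
      by rewrite /phi e powR0 ?gt_eqF// mulr_ge0 ?powR_ge0 ?peak_ge0.
    apply: (@le_trans _ _ ((D * dyadic m `^ (- (2 * s))) `^ p)).
      by apply: ler_powR2r => //; [exact: ltW|exact: peak_ge0].
    rewrite powRM ?powR_ge0 ?(ltW D0)// ler_wpM2l ?powR_ge0// -powRrM.
    apply: le_trans (peak_ge_term n mN xm); apply: ger_powR.
      by rewrite dyadic_gt0 dyadic_le1.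
    by rewrite mulNr lerN2 mulrC.
  have hN : (\int[mu]_x (phi x `^ p)%:E <=
      ((D * (N.+1%:R * 2 ^+ d.+1) `^ p^-1) `^ p)%:E)%E.
    apply: (@le_trans _ _ (\int[mu]_x ((D `^ p)%:E * (peak n N.+1 x)%:E))%E).
      apply: ge0_integral_mono => x; first by rewrite lee_fin powR_ge0.
      by rewrite -EFinM lee_fin.
    rewrite ge0_integralZl//=; last 3 first.
    - by apply/measurable_EFinP; exact: measurable_peak.
    - by move=> z _; rewrite lee_fin peak_ge0.
    - by rewrite lee_fin powR_ge0.
    rewrite integral_peak -EFinM lee_fin [leRHS]powRM ?powR_ge0 ?(ltW D0)//.
    by rewrite -powRrM mulVf ?gt_eqF// powRr1.
  have [z zN hz] := hC phi _ _ mphi phiB (mulr_ge0 (ltW D0) (powR_ge0 _ _)) hN N.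
  rewrite -lee_fin; apply: le_trans hz.
  have TE : T phi z = (\sum_(j < N.+1) (dyadic j `^ (- (2 * s)))%:E * T \1_(dyadic_cube j) z)%E.
    have mI j := measurable_indic (measurable_dyadic_cube j) : measurable_fun setT (\1_(dyadic_cube j) : sp -> R).
    transitivity (\sum_(j < N.+1) \int[mu]_x
        (K z x * (dyadic j `^ (- (2 * s)) * \1_(dyadic_cube j) x)%:E))%E; last first.
      by apply: eq_bigr => j _; rewrite mul_Hpar_int ?powR_ge0.
    rewrite -ge0_integral_sum//.
    - apply: eq_integral => x _; rewrite /phi /peak -sumEFin ge0_sume_distrr//.
      by move=> j _; rewrite lee_fin mulr_ge0 ?powR_ge0.
    - move=> j; apply: measurable_kernel_mul.
      by apply: measurable_funM; [exact: measurable_cst|exact: mI].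
    - by move=> j x _; rewrite mule_ge0 ?Hpar_kernel_ge0// lee_fin mulr_ge0 ?powR_ge0.
  rewrite TE.
  apply: (@le_trans _ _ (\sum_(j < N.+1) (c * 2 ^+ d.+1)%:E)%E).
    by rewrite sumEFin sumr_const card_ord lee_fin mulr_natl.
  apply: lee_sum => j _.
  have dj := dyadic_gt0 j.
  apply: (@le_trans _ _ ((dyadic j `^ (- (2 * s)))%:E *
      (c * dyadic j `^ (2 * s - n) * (2 * dyadic j) ^+ d.+1)%:E)%E); last first.
    rewrite lee_pmul2l ?lte_fin ?powR_gt0//; apply: hc => //.
    by apply: dyadic_cube_sub zN; rewrite -ltnS.
  rewrite -EFinM lee_fin le_eqVlt; apply/orP; left; apply/eqP.
  rewrite exprMn -[dyadic j ^+ d.+1]powR_mulrn ?(ltW dj)//.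
  transitivity (c * 2 ^+ d.+1 * (dyadic j `^ (- (2 * s)) * dyadic j `^ (2 * s - n) * dyadic j `^ n)).
    rewrite -!powRD; try by rewrite (gt_eqF dj) implybT.
    by rewrite (_ : - (2 * s) + (2 * s - n) + n = 0) ?powRr0 ?mulr1//; ring.
  ring.
pose b := C * (D * (2 ^+ d.+1) `^ p^-1).
have b0 : 0 < b by rewrite !mulr_gt0// powR_gt0.
apply: (@powR_nat_le_absurd (c * 2 ^+ d.+1 / b) (1 - p^-1)).
- by rewrite divr_gt0// mulr_gt0.
- by rewrite subr_gt0 invf_lt1.
move=> N; rewrite mulrAC ler_pdivrMr// subKr.
have := h N; rewrite powRM ?(ltW w0)// => h'.
apply: le_trans (_ : N.+1%:R * (c * 2 ^+ d.+1) <= _); first by rewrite mulrC.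
by apply: (le_trans h'); rewrite /b le_eqVlt; apply/orP; left; apply/eqP; ring.
Qed.

End necessity.

(** * Admissible exponents *)

Theorem theorem5p2 (R : realType) (d : nat) (alpha : R) (hd : (1 <= d)%N)
    (halpha0 : 0 < alpha) (halpha1 : alpha < d.+1%:R) :
  (forall q : \bar R, (1 <= q)%E ->
     Hpar_pow_bounded d (alpha / 2) 1%E q <->
     (1 <= q)%E /\ (q < (d.+1%:R / (d.+1%:R - alpha))%:E)%E)
  /\
  (forall p : \bar R, (1 <= p)%E ->
     Hpar_pow_bounded d (alpha / 2) p +oo%E <->
     ((d.+1%:R / alpha)%:E < p)%E)
  /\
  (forall p q : R, 1 < p -> 1 < q ->
     1 / p - alpha / d.+1%:R <= 1 / q -> 1 / q < 1 / p ->
     Hpar_pow_bounded d (alpha / 2) p%:E q%:E).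
Proof.
have s0 : 0 < alpha / 2 by rewrite divr_gt0.
have s2 : 2 * (alpha / 2) = alpha by rewrite mulrC divfK.
have sn : 2 * (alpha / 2) < d.+1%:R by rewrite s2.
have na0 : 0 < d.+1%:R - alpha by rewrite subr_gt0.
split; last split.
- move=> [q|_|//]; last first.
    split=> [/(Hpar_pow_unbounded_L1_infty hd s0 sn)//|[_ h]].
    by move: h; rewrite ltNge leey.
  rewrite lee_fin => q1; split=> [hb|[_]].
    split=> //; rewrite lte_fin ltNge; apply/negP => h.
    apply: (@Hpar_pow_unbounded_L1_Lq R d _ hd s0 sn q _ _ hb).
      exact: lt_le_trans q1.
    by rewrite s2 mulrC -ler_pdivrMr.
  rewrite lte_fin => qn; move: q1; rewrite le_eqVlt => /predU1P[<-|q1].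
    exact: Hpar_pow_bounded_L1_L1.
  by apply: Hpar_pow_bounded_L1_Lq => //; rewrite s2.
- move=> [p|_|//]; last first.
    by split=> [_|_]; [exact: ltry|exact: Hpar_pow_bounded_infty].
  rewrite lee_fin lte_fin => p1; split=> [hb|np]; last first.
    by apply: Hpar_pow_bounded_Lp_infty => //; rewrite s2.
  rewrite ltNge; apply/negP => h.
  move: p1; rewrite le_eqVlt => /predU1P[p1|p1].
    apply: (@Hpar_pow_unbounded_L1_infty R d _ hd s0 sn).
    by move: hb; rewrite -p1.
  by apply: (Hpar_pow_unbounded_Lp_infty hd s0 sn p1 _ hb); rewrite s2 -ler_pdivlMr.
- move=> p q p1 q1; rewrite !div1r => h1 h2.
  by apply: Hpar_pow_bounded_Lp_Lq => //; rewrite s2.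
Qed.
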